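(* Let $\hat k\ge0$ be such that $\mu_k\ge0$ for all $k>\hat k$, and suppose that for each $k=0,\dots,\hat k$ an even $N=N(k)>0$ is given such that $\mathcal{L}_k^{(N)}$ is invertible and $\rho_k<1$. Let $$\delta=\max\left(\max_{k=0,\dots,\hat k}\frac{\beta_k}{1-\rho_k},\ 1.455\right).$$ Then $$\|\mathcal{L}^{-1}\|_{B(X_{\nu,1})}\le\delta.$$
   Context: Let $\nu\ge1$, $h>0$, let $\lambda_k=\sum_{\ell=0}^d\gamma_{2\ell}(-1)^\ell k^{2\ell}$ ($k\ge0$, $\gamma_{2\ell}\in\mathbb{R}$) satisfy $\lambda_k\to-\infty$, and set $\mu_k=-\frac h2\lambda_k$. $\ell^1$ is the space of real sequences $y=(y_j)_{j\ge0}$ with $\|y\|_{\ell^1}=|y_0|+2\sum_{j\ge1}|y_j|<\infty$ (same formula for finite vectors $(y_0,\dots,y_N)$), and $\|\cdot\|_{B(\ell^1)}$ is the induced operator norm. $X_{\nu,1}$ is the space of real sequences $a=(a_{k,j})_{k,j\ge0}$ with $\|a\|_{X_{\nu,1}}=\|a_0\|_{\ell^1}+2\sum_{k\ge1}\|a_k\|_{\ell^1}\nu^k<\infty$, where $a_k=(a_{k,j})_{j\ge0}$; $\|\cdot\|_{B(X_{\nu,1})}$ is the induced operator norm. For each $k$, $(\mathcal{L}_ky)_0=y_0+2\sum_{\ell\ge1}(-1)^\ell y_\ell$ and $(\mathcal{L}_ky)_j=\mu_ky_{j-1}+2j\,y_j-\mu_ky_{j+1}$ for $j\ge1$; $\mathcal{L}_k^{(N)}$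 is its $(N+1)\times(N+1)$ upper-left truncation (indices $0,\dots,N$). $\mathcal{L}$ is block diagonal: $(\mathcal{L}a)_k=\mathcal{L}_ka_k$. The statement includes that $\mathcal{L}$ is invertible on $X_{\nu,1}$: for every $y\in X_{\nu,1}$ there is a unique $a\in X_{\nu,1}$ with $\mathcal{L}a=y$, and $\mathcal{L}^{-1}:y\mapsto a$ is bounded. With $c_1$, $c_{N+1}$ the first and last columns of $(\mathcal{L}_k^{(N)})^{-1}$, $N=N(k)$, define $\rho^{(1)}=\frac1{N+1}(\|c_1\|_{\ell^1}+1)$, $\rho^{(2)}=\|c_{N+1}+\frac1{N+2}c_1\|_{\ell^1}+\frac1{N+2}$, $\rho^{(3)}=\frac2{(N+1)(N+3)}\|c_1\|_{\ell^1}+\frac1{N+1}+\frac1{N+3}$, $\rho_k=\frac{|\mu_k|}2\max\{\rho^{(1)},\rho^{(2)},\rho^{(3)}\}$, and $\beta_k=\max\{\|(\mathcal{L}_k^{(N)})^{-1}\|_{B(\ell^1)},\frac1{2(N+1)}(\|c_1\|_{\ell^1}+1)\}$. *)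

(* Defs.v *)
From HB Require Import structures.
From mathcomp Require Import all_boot all_order all_algebra.
From mathcomp Require Import all_classical all_reals all_analysis.
Set Implicit Arguments.
Unset Strict Implicit.
Unset Printing Implicit Defensive.
Import Order.TTheory GRing.Theory Num.Theory.
Import numFieldNormedType.Exports.
Local Open Scope classical_set_scope.
Local Open Scope ring_scope.

(* [gamma (2 * l)] is the coefficient gamma_{2l}; the values of [gamma] at odd
   indices are not used. *)
Definition lambda {R : realType} (d : nat) (gamma : nat -> R) (k : nat) : R :=
  \sum_(l < d.+1) gamma (2 * l)%N * (-1) ^+ l * k%:R ^+ (2 * l).

Definition mu {R : realType} (h : R) (d : nat) (gamma : nat -> R) (k : nat) : R :=
  - (h / 2) * lambda d gamma k.

(* The norms are extended-real valued on all sequences; the spaces consist of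
   the sequences with a finite norm. *)
Definition ell1_norm {R : realType} (y : nat -> R) : \bar R :=
  (`|y 0%N|%:E + 2%:E * \sum_(1 <= j <oo) `|y j|%:E)%E.

Definition X_norm {R : realType} (nu : R) (a : nat -> nat -> R) : \bar R :=
  (ell1_norm (a 0%N)
   + 2%:E * \sum_(1 <= k <oo) (ell1_norm (a k) * (nu ^+ k)%:E))%E.

Definition in_X {R : realType} (nu : R) (a : nat -> nat -> R) : Prop :=
  (X_norm nu a < +oo)%E.

Definition ell1_vnorm {R : realType} {N : nat} (y : 'cV[R]_N.+1) : R :=
  `|y ord0 ord0| + 2 * \sum_(i < N.+1 | i != ord0) `|y i ord0|.

Definition op_norm {R : realType} {V W : Type}
    (normV : V -> \bar R) (normW : W -> \bar R) (T : V -> W) : \bar R :=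
  ereal_sup [set normW (T x) | x in [set x | (normV x <= 1)%E]].

(* [fine] is harmless here: the operator norm of a matrix is finite. *)
Definition mx_op_norm {R : realType} {N : nat} (A : 'M[R]_N.+1) : R :=
  fine (op_norm (fun y => (ell1_vnorm y)%:E) (fun y => (ell1_vnorm y)%:E)
          (fun y : 'cV[R]_N.+1 => A *m y)).

(* The sum in row 0 is the limit of its partial sums, which exists as soon as
   [y] is in ell^1. *)
Definition Lop {R : realType} (m : R) (y : nat -> R) (j : nat) : R :=
  match j with
  | 0 => y 0%N + 2 * limn (fun n => \sum_(1 <= l < n) (-1) ^+ l * y l)
  | i.+1 => m * y i + (2 * j)%:R * y j - m * y j.+1
  end.

(* The (i, j) entry of the infinite matrix [Lop m] is row i of its value at the
   j-th unit sequence. *)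
Definition Ltrunc {R : realType} (m : R) (N : nat) : 'M[R]_N.+1 :=
  \matrix_(i < N.+1, j < N.+1) Lop m (fun l => (l == j)%:R) i.

Definition Lblock {R : realType} (mu : nat -> R) (a : nat -> nat -> R) :
    nat -> nat -> R :=
  fun k => Lop (mu k) (a k).

Definition first_col {R : realType} (m : R) (N : nat) : 'cV[R]_N.+1 :=
  col ord0 (invmx (Ltrunc m N)).

Definition last_col {R : realType} (m : R) (N : nat) : 'cV[R]_N.+1 :=
  col ord_max (invmx (Ltrunc m N)).

Definition rho1 {R : realType} (m : R) (N : nat) : R :=
  (N.+1%:R)^-1 * (ell1_vnorm (first_col m N) + 1).

Definition rho2 {R : realType} (m : R) (N : nat) : R :=
  ell1_vnorm (last_col m N + (N.+2%:R)^-1 *: first_col m N) + (N.+2%:R)^-1.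

Definition rho3 {R : realType} (m : R) (N : nat) : R :=
  2 / (N.+1%:R * N.+3%:R) * ell1_vnorm (first_col m N)
  + (N.+1%:R)^-1 + (N.+3%:R)^-1.

Definition rho {R : realType} (m : R) (N : nat) : R :=
  `|m| / 2 * Num.max (rho1 m N) (Num.max (rho2 m N) (rho3 m N)).

Definition beta {R : realType} (m : R) (N : nat) : R :=
  Num.max (mx_op_norm (invmx (Ltrunc m N)))
    ((2 * N.+1%:R)^-1 * (ell1_vnorm (first_col m N) + 1)).

(* The base value 1455/1000 of the iterated maximum is the second argument of
   the outer maximum max(max_k ..., 1.455). *)
Definition delta {R : realType} (mu : nat -> R) (N : nat -> nat) (khat : nat) : R :=
  \big[Num.max/1455%:R / 1000%:R]_(k < khat.+1)
    (beta (mu k) (N k) / (1 - rho (mu k) (N k))).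

(* [S] maps every y in [D] to the unique preimage of y under [T] in [D]. *)
Definition is_inverse_on {V : Type} (D : V -> Prop) (T S : V -> V) : Prop :=
  forall y, D y -> unique (fun a => D a /\ T a = y) (S y).

(* Main.v *)
Require Import Defs.
From mathcomp Require Import all_boot all_order all_algebra.
From mathcomp Require Import all_classical all_reals all_analysis.
From mathcomp Require Import ring lra zify.
Import Order.TTheory GRing.Theory Num.Theory.
Import numFieldNormedType.Exports.
Set Implicit Arguments.
Unset Strict Implicit.
Unset Printing Implicit Defensive.
Local Open Scope classical_set_scope.
Local Open Scope ring_scope.

(** Since the operator is block diagonal and [nu] only enters through positive
    weights, it suffices to invert every block [Lop m] on ell^1 with a bound
    [K] on the inverse ([block_bound m K]); the weighted sum over the blocks
    then carries the largest block bound over to the whole operator.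

    Blocks with a good truncation ([block_bound_rho]).  Let [A] be the inverse
    of the truncation of order [N].  Solving row [j] for [y j] when [j > N], and
    the rows up to [N] by [A], turns [Lop m y = f] into a fixed-point equation
    [y = step m N f y] whose right-hand side is affine in [y].  Its value at [0]
    is the natural approximate inverse (the block [A], the diagonal [1 / (2 j)]
    beyond, and a correction by the first column of [A] that restores row [0]),
    applied to [f]; the norm of that operator is at most [beta].  Its linear part
    is the identity minus the approximate inverse times [L]: it kills the unit
    sequences below [N], and its columns [N], [N + 1] and [j >= N + 2] have
    norms controlled by [rho1], [rho2] and [rho3].  Hence it is a contraction of
    ratio [rho], and the fixed point exists, is unique, and has norm at most
    [beta / (1 - rho)] times that of [f].

    Blocks with [0 <= m] ([block_bound_ge0]).  The same theorem is applied, now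
    with [N] as large as needed.  In the unknowns [(-1) ^ n y_n] the rows of the
    truncation become the three-term recurrence of the modified Bessel
    functions.  It has a positive decaying solution, computed backwards from
    [N], and a solution of growing size vanishing at [0]; together they give a
    discrete Green's function, hence every column of the inverse truncation.
    The first column is the decaying solution divided by its sum, so it has norm
    [1].  Telescoping the recurrence and the monotonicity of the decaying
    solution bound the other columns by [4 / 3] of their weight, and show that
    the last one is [O(1 / N)].  So [beta <= 4 / 3] and [rho -> 0]; once
    [rho <= 1 / 12] the bound is [16 / 11], just below [1.455]. *)

(** * Continuants *)

Section Continuant.
Context {R : realFieldType}.
Implicit Types (c : nat -> R).

(** The solution of [x_(n + 2) = x_n + c_(n + 1) x_(n + 1)] started at [0, 1]:
    run forwards it is the growing solution of the recurrence, run backwards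
    from the truncation index it is the decaying one. *)
Fixpoint continuant c (n : nat) : R :=
  match n with
  | 0 => 0
  | n'.+1 => match n' with
             | 0 => 1
             | n''.+1 => continuant c n'' + c n' * continuant c n'
             end
  end.

Lemma continuantSS c n :
  continuant c n.+2 = continuant c n + c n.+1 * continuant c n.+1.
Proof. by []. Qed.

Lemma continuant_ge0 c n : (forall k, 0 <= c k) -> 0 <= continuant c n.
Proof.
move=> c0; have [] : 0 <= continuant c n /\ 0 <= continuant c n.+1; last by [].
elim: n => [|n [IH1 IH2]]; first by split => //=; rewrite ler01.
by split=> //; rewrite continuantSS addr_ge0 ?mulr_ge0.
Qed.

Lemma continuant_gt0 c n k : (forall k, 0 <= c k) ->
  (forall k, (0 < k < n)%N -> 0 < c k) -> (0 < k <= n)%N -> 0 < continuant c k.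
Proof.
move=> c0 cp; elim: k => [//|[|k] IH] /andP[_ kn]; first exact: ltr01.
rewrite continuantSS; apply: ltr_wpDl; first exact: continuant_ge0.
by apply: mulr_gt0; [apply: cp | apply: IH; rewrite /= ltnW].
Qed.

End Continuant.

(** * Growing and decaying solutions of the recurrence *)

Section Green.
Context {R : realFieldType} (m : R) (N : nat).
Hypothesis m_gt0 : 0 < m.

(** With [z_n = (-1) ^ n y_n], row [n] of [Lop m y = 0] reads
    [z_(n - 1) = z_(n + 1) + (2 n / m) z_n], the recurrence of the modified
    Bessel functions.  The solution [decaying] vanishes at [N + 1]; [growing] is,
    up to the sign [(-1) ^ n], the one that vanishes at [0]. *)
Definition stepc (n : nat) : R := 2 * n%:R / m.
Definition growing (n : nat) : R := continuant stepc n.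
Definition decaying (n : nat) : R :=
  continuant (fun k => stepc (N.+1 - k)) (N.+1 - n).

Local Notation c := stepc.
Local Notation q := growing.
Local Notation b := decaying.

Lemma stepc_ge0 n : 0 <= c n.
Proof. by rewrite /c divr_ge0 ?mulr_ge0 ?ler0n ?ltW. Qed.

Lemma stepc_gt0 n : (0 < n)%N -> 0 < c n.
Proof. by move=> n0; rewrite /c divr_gt0 ?mulr_gt0 ?ltr0n. Qed.

Lemma mul_stepc n : m * c n = 2 * n%:R.
Proof. by rewrite /c mulrC divfK ?gt_eqF. Qed.

Lemma ler_stepc n k : (n <= k)%N -> c n <= c k.
Proof. by move=> nk; rewrite /c ler_pM2r ?invr_gt0 // ler_pM2l ?ltr0n // ler_nat. Qed.

Lemma growing0 : q 0 = 0. Proof. by []. Qed.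
Lemma growing1 : q 1 = 1. Proof. by []. Qed.
Lemma growingSS n : q n.+2 = q n + c n.+1 * q n.+1. Proof. by []. Qed.
Lemma growing_ge0 n : 0 <= q n.
Proof. exact/continuant_ge0/stepc_ge0. Qed.
Lemma growing_gt0 n : (0 < n)%N -> 0 < q n.
Proof.
move=> n0; apply: (@continuant_gt0 _ _ n) => [|k /andP[k0 _]|]; last by rewrite n0 /=.
- exact: stepc_ge0.
- exact: stepc_gt0.
Qed.

Lemma decaying_out n : (N < n)%N -> b n = 0.
Proof. by move=> Nn; rewrite /b (eqP Nn). Qed.

Lemma decayingN : b N = 1.
Proof. by rewrite /b subSnn. Qed.

Lemma decayingSS n : (n < N)%N -> b n = c n.+1 * b n.+1 + b n.+2.
Proof.
move=> nN; rewrite /b.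
have -> : (N.+1 - n = (N.+1 - n.+2).+2)%N by lia.
have -> : (N.+1 - n.+1 = (N.+1 - n.+2).+1)%N by lia.
by rewrite continuantSS addrC; congr (c _ * _ + _); lia.
Qed.

Lemma decaying_ge0 n : 0 <= b n.
Proof. by apply: continuant_ge0 => k; exact: stepc_ge0. Qed.

Lemma decaying_gt0 n : (n <= N)%N -> 0 < b n.
Proof.
move=> nN; apply: (@continuant_gt0 _ _ N.+1).
- by move=> k; exact: stepc_ge0.
- by move=> k /andP[_ kN]; apply: stepc_gt0; rewrite subn_gt0.
- by rewrite subn_gt0 ltnS nN /= leq_subr.
Qed.

(** The ratios [r_n = b_n / b_(n - 1)] satisfy [r_n = 1 / (c_n + r_(n + 1))], and
    the two-sided bound [r_(n + 1) <= r_n <= r_(n + 1) + 2 / m] is preserved from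
    [n + 1] to [n]: the upper bound at [n + 1] gives the lower one at [n], and
    conversely.  It starts at [n = N], where [r_(N + 1) = 0] and
    [r_N = m / (2 N)], as soon as [m ^ 2 <= 4 N]. *)
Lemma decaying_ratio_mono n : m ^+ 2 <= 4 * N%:R -> (n < N)%N ->
  b n.+2 / b n.+1 <= b n.+1 / b n <= b n.+2 / b n.+1 + 2 / m.
Proof.
move=> mN; move: n.
(* The induction goes down from [n = N - 1]. *)
suff H d n : (d < N)%N -> n = (N - d.+1)%N ->
    b n.+2 / b n.+1 <= b n.+1 / b n <= b n.+2 / b n.+1 + 2 / m.
  by move=> n nN; apply: (H (N - n.+1)%N); lia.
elim: d n => [|d IH] n dN ->.
  have E : (N - 1).+1 = N by rewrite subn1 prednK.
  have N1 : (N - 1 < N)%N by lia.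
  have := decayingSS N1; rewrite E.
  rewrite decayingN (decaying_out (ltnSn N)) mul0r mulr1 addr0 add0r => ->.
  rewrite mul1r invr_ge0 stepc_ge0 /= /c.
  rewrite invfM invrK ler_pdivlMr // -mulrA -expr2 mulrC ler_pdivrMr; first lra.
  by rewrite mulr_gt0 ?ltr0n.
have E : (N - d.+1)%N = (N - d.+2).+1 by lia.
have := IH _ (ltnW dN) erefl; rewrite E; set k := (N - d.+2)%N => /andP[H1 H2].
have [nN n1N] : (k < N)%N /\ (k.+1 < N)%N by rewrite /k; lia.
have p0 := decaying_gt0 (ltnW nN). have p1 := decaying_gt0 nN.
have p2 := decaying_gt0 n1N.
set r := b k.+2 / b k.+1 in H1 H2 *; set s := b k.+3 / b k.+2 in H1 H2.
have r0 : 0 < r by rewrite divr_gt0.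
have Er : r * (c k.+2 + s) = 1.
  have := decayingSS n1N; rewrite /r /s => Eb.
  have -> : c k.+2 + b k.+3 / b k.+2 = b k.+1 / b k.+2.
    by rewrite Eb; field; rewrite gt_eqF.
  by field; rewrite !gt_eqF.
have s0 : 0 <= s by rewrite divr_ge0 // ?decaying_ge0.
have c1 := @stepc_gt0 k.+1 isT.
have -> : b k.+1 / b k = (c k.+1 + r)^-1.
  rewrite (decayingSS nN) /r; field.
  by rewrite -(decayingSS nN) !gt_eqF.
have Ec : c k.+2 = c k.+1 + 2 / m.
  by rewrite /c -[k.+2]addn1 natrD; field; rewrite gt_eqF.
have m2 : 0 < 2 / m by rewrite divr_gt0 ?ltr0n.
set e := 2 / m in m2 Ec H2 *.
have rc : 0 < c k.+1 + r by rewrite addr_gt0.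
apply/andP; split.
  rewrite -[leRHS]mul1r ler_pdivlMr // -Er Ec ler_pM2l //; lra.
rewrite -[leLHS]mul1r ler_pdivrMr // -Er Ec.
have h : 0 <= r * (r - s) by rewrite mulr_ge0 ?subr_ge0 ?(ltW r0).
have h2 : 0 <= e * c k.+1 by rewrite mulr_ge0 ?ltW.
nra.
Qed.

(** As [2 / m <= c_n], the upper bound on the ratio gives
    [r_n <= r_(n + 1) + c_n = 1 / r_n], that is [r_n <= 1]. *)
Lemma decaying_nincr n : m ^+ 2 <= 4 * N%:R -> b n.+1 <= b n.
Proof.
move=> mN; have [Nn|nN] := leqP N n.
  by rewrite decaying_out ?decaying_ge0.
have /andP[_] := decaying_ratio_mono mN nN.
have p0 := decaying_gt0 (ltnW nN). have p1 := decaying_gt0 nN.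
have -> : b n.+2 / b n.+1 = b n / b n.+1 - c n.+1.
  by rewrite (decayingSS nN); field; rewrite gt_eqF.
have c1 : 2 / m <= c n.+1.
  by have := @ler_stepc 1 n.+1 isT; rewrite {1}/c mulr1.
move=> H; have {H c1} : b n.+1 / b n <= b n / b n.+1 by lra.
rewrite ler_pdivrMr // mulrAC ler_pdivlMr // -!expr2.
by rewrite ler_pXn2r // nnegrE ltW.
Qed.

(** Each term is [c_k b_k = b_(k - 1) - b_(k + 1)], so the sum telescopes. *)
Lemma decaying_weighted_tail n : (n <= N)%N ->
  \sum_(n.+1 <= k < N.+1) c k * b k <= b n + b n.+1.
Proof.
move=> nN; rewrite -(subKn nN); move: (N - n)%N (leq_subr n N) => d.
elim: d => [|d IH] dN; first by rewrite subn0 big_geq // addr_ge0 ?decaying_ge0.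
have E : (N - d)%N = (N - d.+1).+1 by lia.
have := IH (ltnW dN); rewrite E => {}IH.
rewrite big_ltn; last by lia.
rewrite (@decayingSS (N - d.+1)); last by lia.
by move: IH; lra.
Qed.

Lemma decaying_tail n : (n <= N)%N ->
  c n.+1 * \sum_(n.+1 <= k < N.+1) b k <= b n + b n.+1.
Proof.
move=> /decaying_weighted_tail; apply: le_trans.
rewrite mulr_sumr !big_nat; apply: ler_sum => k /andP[nk _].
by apply: ler_wpM2r; [exact: decaying_ge0 | exact: ler_stepc].
Qed.

(** By induction: each step increases the right-hand side by
    [m / 2 * c_(j + 1) * q_(j + 1)], which is [(j + 1) * q_(j + 1)]. *)
Lemma growing_sum j : \sum_(0 <= n < j.+1) q n <= m / 2 * (q j.+1 + q j).
Proof.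
elim: j => [|j IH]; first by rewrite big_nat1 growing0 growing1 addr0 mulr1 divr_ge0 ?ltW.
rewrite big_nat_recr //= growingSS.
have : m / 2 * (c 1 * q j.+1) <= m / 2 * (c j.+1 * q j.+1).
  rewrite ler_pM2l ?divr_gt0 //; apply: ler_wpM2r; first exact: growing_ge0.
  exact: ler_stepc.
have -> : m / 2 * (c 1 * q j.+1) = q j.+1 by rewrite /c; field; rewrite gt_eqF.
move: IH; lra.
Qed.

(** The factor [1 + (-1) ^ (j + 1 + n)] is [2] on the indices of the parity of
    [j + 1] and [0] on the others.  Along one parity class [q] is
    nondecreasing, and below [j + 1] the class has at most [j / 2] indices where
    [q] does not vanish. *)
Lemma growing_same_parity_sum j :
  \sum_(0 <= n < j.+1) q n * (1 + (-1) ^+ (j.+1 + n)) <= j%:R * q j.+1.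
Proof.
suff [] : \sum_(0 <= n < j.+1) q n * (1 + (-1) ^+ (j.+1 + n)) <= j%:R * q j.+1 /\
  \sum_(0 <= n < j.+2) q n * (1 + (-1) ^+ (j.+2 + n)) <= j.+1%:R * q j.+2 by [].
elim: j => [|j [IH1 IH2]].
  split; first by rewrite big_nat1 growing0 !mul0r.
  rewrite big_nat_recr // big_nat1 /= growing0 mul0r add0r !mul1r -signr_odd /=.
  by rewrite subrr growing_ge0.
split=> //; rewrite 2?big_nat_recr //=.
have -> : (-1) ^+ (j.+3 + j.+2) = -1 :> R by rewrite -signr_odd (_ : odd _ = true) ?expr1 //; lia.
have -> : (-1) ^+ (j.+3 + j.+1) = 1 :> R by rewrite -signr_odd (_ : odd _ = false) ?expr0 //; lia.
rewrite subrr mulr0 addr0.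
under eq_bigr do rewrite 2!addSn exprS exprS mulN1r mulN1r opprK.
apply: (@le_trans _ _ (j.+2%:R * q j.+1)).
  by move: IH1; rewrite -[j.+2]addn2 natrD; lra.
rewrite ler_pM2l ?ltr0n // growingSS lerDl mulr_ge0 ?stepc_ge0 ?growing_ge0 //.
Qed.

End Green.

(** * The discrete Green's function *)

Section GreenFunction.
Context {R : realFieldType} (m : R) (N : nat).
Hypothesis m_gt0 : 0 < m.

Local Notation c := (stepc m).
Local Notation q := (growing m).
Local Notation b := (decaying m N).

(** The Green's function for the right-hand side at row [j + 1], vanishing at
    [0]: the growing solution up to [j + 1] and the decaying one from there on,
    scaled by their Casorati determinant.  The sign keeps the value at [j + 1]
    positive. *)
Definition green (j n : nat) : R :=
  (m * (q j * b j.+1 + q j.+1 * b j))^-1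
  * (if (n <= j)%N then (-1) ^+ (j.+1 + n) * q n * b j.+1 else q j.+1 * b n).

Lemma green_out j n : (j < N)%N -> (N < n)%N -> green j n = 0.
Proof.
by move=> jN Nn; rewrite /green leqNgt (ltn_trans jN Nn) /= (decaying_out m Nn) !mulr0.
Qed.

Lemma green0 j : green j 0 = 0.
Proof. by rewrite /green leq0n growing0 !(mulr0, mul0r). Qed.

Lemma casorati_gt0 j : (j < N)%N -> 0 < m * (q j * b j.+1 + q j.+1 * b j).
Proof.
move=> jN; apply: mulr_gt0 => //; apply: ltr_wpDl.
  by rewrite mulr_ge0 ?growing_ge0 ?decaying_ge0.
by rewrite mulr_gt0 ?growing_gt0 ?decaying_gt0 // ltnW.
Qed.

Lemma growing_rec n : m * q n.+2 = m * q n + 2 * n.+1%:R * q n.+1.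
Proof. by rewrite growingSS mulrDr mulrA mul_stepc. Qed.

Lemma decaying_rec n : (n < N)%N ->
  m * b n = 2 * n.+1%:R * b n.+1 + m * b n.+2.
Proof. by move=> nN; rewrite decayingSS // mulrDr mulrA mul_stepc. Qed.

Lemma green_eq j n : (j < N)%N -> (n < N)%N ->
  - m * green j n + 2 * n.+1%:R * green j n.+1 + m * green j n.+2 = (n == j)%:R.
Proof.
move=> jN nN; have D0 := casorati_gt0 jN.
have [nj|jn|nj] := ltngtP n j.
- rewrite /green nj (ltnW nj).
  have -> : (if (n.+2 <= j)%N then (-1) ^+ (j.+1 + n.+2) * q n.+2 * b j.+1
             else q j.+1 * b n.+2) = (-1) ^+ (j.+1 + n) * q n.+2 * b j.+1.
    case: leqP => [jn|_]; last by rewrite !addnS 2!exprS mulrA mulrNN !mul1r.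
    have -> : j = n.+1 by lia.
    by rewrite -signr_odd (_ : odd _ = false) ?expr0 ?mul1r 1?mulrC //; lia.
  rewrite addnS [(-1) ^+ (j.+1 + n).+1]exprS.
  have := growing_rec n; set D := _^-1; set s := (-1) ^+ (j.+1 + n) => E.
  transitivity (D * s * b j.+1 * (m * q n.+2 - m * q n - 2 * n.+1%:R * q n.+1)).
    by ring.
  by rewrite E mulr0n; ring.
- rewrite /green.
  have -> : (n <= j)%N = false by lia.
  have -> : (n < j)%N = false by lia.
  have -> : (n.+1 < j)%N = false by lia.
  have := decaying_rec nN; set D := _^-1 => E.
  transitivity (D * q j.+1 * (2 * n.+1%:R * b n.+1 + m * b n.+2 - m * b n)).
    by ring.
  by rewrite E mulr0n; ring.
- rewrite nj in nN *; rewrite /green leqnn ltnn ltnNge leqnSn /=.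
  rewrite addSn exprS -signr_odd addnn odd_double expr0 mulr1.
  set D := (X in X^-1) in D0 *; have E := decaying_rec nN.
  apply: (@mulfI _ D); first by rewrite gt_eqF.
  transitivity (m * q j * b j.+1 + q j.+1 * (2 * j.+1%:R * b j.+1 + m * b j.+2)).
    by field; rewrite gt_eqF.
  by rewrite -E mulr1n mulr1 /D; ring.
Qed.

(** Taking [s = 1] and [s = -1] gives twice the positive and twice the negative
    part of the column; [s = 0] gives its absolute sum. *)
Lemma green_sumE j (s : R) : (j < N)%N ->
  \sum_(0 <= n < N.+1) (`|green j n| + s * green j n) =
  (m * (q j * b j.+1 + q j.+1 * b j))^-1 *
  (b j.+1 * (\sum_(0 <= n < j.+1) q n * (1 + s * (-1) ^+ (j.+1 + n)))
   + (1 + s) * (q j.+1 * \sum_(j.+1 <= n < N.+1) b n)).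
Proof.
move=> jN; have D0 := casorati_gt0 jN.
rewrite (@big_cat_nat _ _ _ j.+1) //=; last exact: ltnW.
rewrite mulrDr; congr (_ + _).
  rewrite !mulr_sumr !big_nat; apply: eq_bigr => n /andP[_ nj].
  rewrite /green -ltnS nj !normrM normfV (gtr0_norm D0) normrX normrN1 expr1n.
  rewrite !ger0_norm ?decaying_ge0 ?growing_ge0 //.
  set D := _^-1; set t := (-1) ^+ _; ring.
rewrite !mulr_sumr !big_nat; apply: eq_bigr => n /andP[nj _].
rewrite /green leqNgt nj /= !normrM normfV (gtr0_norm D0).
rewrite !ger0_norm ?decaying_ge0 ?growing_ge0 //.
set D := _^-1; ring.
Qed.

Hypothesis N_large : m ^+ 2 <= 4 * N%:R.

(** The negative values only occur below [j + 1], where [growing_sum] bounds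
    their total; monotonicity of the decaying solution turns this bound into the
    Casorati determinant. *)
Lemma green_sumB j : (j < N)%N ->
  \sum_(0 <= n < N.+1) (`|green j n| - green j n) <= 1.
Proof.
move=> jN; have D0 := casorati_gt0 jN.
under eq_bigr do rewrite -mulN1r.
rewrite green_sumE // subrr mul0r addr0 mulrC ler_pdivrMr // mul1r.
have b1 := decaying_ge0 N m_gt0 j.+1.
apply: (@le_trans _ _ (b j.+1 * (m * (q j.+1 + q j)))).
  apply: ler_wpM2l => //.
  have := growing_sum m_gt0 j => /(ler_wpM2l (ler0n R 2)) H.
  apply: le_trans (_ : 2 * (m / 2 * (q j.+1 + q j)) <= _); last lra.
  apply: le_trans H; rewrite mulr_sumr; apply: ler_sum => n _.
  rewrite mulrC; apply: ler_wpM2r; first exact: growing_ge0.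
  by rewrite -signr_odd; case: odd; lra.
have : m * (q j.+1 * b j.+1) <= m * (q j.+1 * b j).
  rewrite ler_pM2l //; apply: ler_wpM2l; first exact: growing_ge0.
  exact: decaying_nincr.
lra.
Qed.

Lemma decaying_bound n : (n < N)%N -> 2 * n.+1%:R * b n.+1 <= m * b n.
Proof.
by move=> nN; rewrite decaying_rec // lerDl mulr_ge0 ?decaying_ge0 ?ltW.
Qed.

Lemma decaying_tail_mu n : (n <= N)%N ->
  2 * n.+1%:R * \sum_(n.+1 <= k < N.+1) b k <= m * (b n + b n.+1).
Proof.
by move=> nN; rewrite -(mul_stepc m_gt0) -mulrA ler_pM2l ?decaying_tail.
Qed.

(** For [j >= 1], the tail contributes at most [2 / (j + 1)] and the values
    below [j + 1] at most [j / (2 (j + 1))], with sum at most [5 / 4].  For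
    [j = 0] only the tail remains, and the crude estimate [2] is not enough: the
    tail bound is applied from index [2], and the recurrence at indices [1] and
    [2] reduces the claim to [0 <= (m - 2) ^ 2 + 4]. *)
Lemma green_sumD j : (2 < N)%N -> (j < N)%N ->
  \sum_(0 <= n < N.+1) (`|green j n| + green j n) <= 4 / 3.
Proof.
move=> N2 jN; have D0 := casorati_gt0 jN.
under eq_bigr do rewrite -[X in _ + X]mul1r.
rewrite green_sumE //; under eq_bigr do rewrite mul1r.
rewrite mulrC ler_pdivrMr //.
have b1 := decaying_ge0 N m_gt0 j.+1. have q1 := growing_ge0 m_gt0 j.+1.
have q0 := growing_ge0 m_gt0 j.
case: j => [|j] in jN D0 b1 q1 q0 *.
  rewrite big_nat1 growing0 growing1 !(mul0r, mulr0, add0r, mul1r).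
  rewrite big_ltn //.
  have N1 : (1 < N)%N by lia.
  have := decaying_tail_mu (ltnW N1); have := decaying_rec jN; have := decaying_rec N1.
  have := decaying_nincr m_gt0 2 N_large.
  set T := \sum_(_ <= _ < _) _.
  have b2 := decaying_ge0 N m_gt0 2.
  move: b1 b2; set x1 := b 1; set x2 := b 2 => b1 b2 h32 E1 E0 hT.
  have h : m * x1 <= (4 + m) * x2.
    have : m * b 3 <= m * x2 by rewrite ler_pM2l.
    by move: E1; lra.
  suff : m / 2 * x1 <= 2 / 3 * x1 + 5 / 6 * (m * x2) by move: hT; lra.
  have m4 : 0 < 4 + m by rewrite addr_gt0.
  rewrite -(ler_pM2l m4).
  have : m * (m * x1) <= m * ((4 + m) * x2) by rewrite ler_pM2l.
  have : 0 <= ((m - 2) ^+ 2 + 4) * x1 by rewrite mulr_ge0 ?addr_ge0 ?sqr_ge0.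
  lra.
set j' := j.+1 in jN D0 b1 q1 q0 *.
set T := \sum_(j'.+1 <= _ < _) _; set P := \sum_(_ <= _ < _) _.
have hP : P <= j'%:R * q j'.+1 := growing_same_parity_sum m_gt0 j'.
have hT := decaying_tail_mu (ltnW jN); rewrite -/T in hT.
have hb := decaying_bound jN.
have hn := decaying_nincr m_gt0 j' N_large.
have B0 := decaying_ge0 N m_gt0 j'.
have J0 : (0 : R) < 2 * j'.+1%:R by rewrite mulr_gt0 ?ltr0n.
have J1 : (1 : R) <= j'%:R by rewrite ler1n.
have J2 : j'.+1%:R = j'%:R + 1 :> R by rewrite -natr1.
apply: (@le_trans _ _ (4 / 3 * (m * (q j'.+1 * b j')))); last first.
  rewrite ler_pM2l ?ler_pM2l ?divr_gt0 ?ltr0n //.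
  by rewrite lerDr mulr_ge0.
rewrite -(ler_pM2l J0).
have {}hP : 2 * j'.+1%:R * b j'.+1 * P <= m * b j' * (j'%:R * q j'.+1).
  apply: (@le_trans _ _ (2 * j'.+1%:R * b j'.+1 * (j'%:R * q j'.+1))).
    by apply: ler_wpM2l => //; rewrite mulr_ge0 // ltW.
  by apply: ler_wpM2r => //; rewrite mulr_ge0 ?ler0n.
have {}hT : 2 * j'.+1%:R * (q j'.+1 * T) <= q j'.+1 * (m * (2 * b j')).
  rewrite mulrCA; apply: ler_wpM2l => //; apply: le_trans hT _.
  by rewrite ler_pM2l //; lra.
have X1 : 0 <= m * (q j'.+1 * b j') by rewrite mulr_ge0 ?mulr_ge0 // ltW.
have X0 : 0 <= m * (q j'.+1 * b j') * (j'%:R - 1).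
  by rewrite mulr_ge0 // subr_ge0.
rewrite J2 in hP hT *.
move: hP hT X0 X1; lra.
Qed.

(** In the last column the tail is a single term [1 / (2 N)] at most, and the
    growing solution has a total comparable with its last value, uniformly in
    [N]. *)
Lemma green_last j : N = j.+2 ->
  \sum_(0 <= n < N.+1) `|green j.+1 n|
    <= (2 * N%:R)^-1 * (1 + m / 2 * (1 + m / 2)).
Proof.
move=> EN; have jN : (j.+1 < N)%N by rewrite EN.
have D0 := casorati_gt0 jN.
have -> : \sum_(0 <= n < N.+1) `|green j.+1 n| =
    (m * (q j.+1 * b N + q N * b j.+1))^-1 * (\sum_(0 <= n < N) q n + q N).
  have := green_sumE 0 jN; under eq_bigr do rewrite mul0r addr0.
  move=> ->; under eq_bigr do rewrite mul0r addr0 mulr1.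
  by rewrite -EN big_nat1 decayingN addr0 !mul1r !mulr1.
have q1 := growing_gt0 m_gt0 (isT : (0 < j.+2)%N). have q0 := growing_ge0 m_gt0 j.+1.
have hb := decaying_bound jN; rewrite -EN decayingN mulr1 in hb.
have N0 : (0 : R) < 2 * N%:R by rewrite EN mulr_gt0 ?ltr0n.
rewrite -EN in q1.
have hq : q j.+1 <= m / 2 * q N.
  have := growing_rec j; rewrite -EN => E.
  have : m * q N >= 2 * q j.+1; last lra.
  rewrite E; have g := growing_ge0 m_gt0 j.
  have : 0 <= m * q j by rewrite mulr_ge0 // ltW.
  have : 0 <= j%:R * q j.+1 by rewrite mulr_ge0.
  rewrite -natr1; lra.
have hs := growing_sum m_gt0 j.+1; rewrite -EN in hs.
rewrite decayingN mulr1; rewrite -EN decayingN mulr1 in D0.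
apply: (@le_trans _ _ ((2 * N%:R * q N)^-1 * (q N * (1 + m / 2 * (1 + m / 2))))); last first.
  rewrite le_eqVlt; apply/orP; left; apply/eqP; field.
  have N1 : 0 < N%:R :> R by rewrite ltr0n {1}EN.
  by rewrite !gt_eqF.
apply: ler_pM.
- by rewrite invr_ge0 ltW.
- by apply: addr_ge0; [apply: sumr_ge0 => n _; exact: growing_ge0 | exact: ltW].
- rewrite lef_pV2 ?posrE //; last by rewrite mulr_gt0.
  have : q N * (2 * N%:R) <= q N * (m * b j.+1) by rewrite ler_pM2l.
  have : 0 <= m * q j.+1 by rewrite mulr_ge0 // ltW.
  lra.
- have : m / 2 * q j.+1 <= m / 2 * (m / 2 * q N) by rewrite ler_pM2l ?divr_gt0.
  move: hs; lra.
Qed.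

End GreenFunction.

(** * Bounds on the ell^1 norm *)

Section Ell1.
Context {R : realType}.
Implicit Types (y z f : nat -> R) (C D : R).

Definition weight (j : nat) : R := if j is 0 then 1 else 2.

(** The ell^1 norm of [y] is at most [C].  Bounding the partial sums keeps the
    statement in the reals and makes it stable under pointwise limits. *)
Definition ell1_le y C := forall n, \sum_(0 <= j < n) weight j * `|y j| <= C.

Definition ell1 y := exists C, ell1_le y C.

Lemma weight_ge1 j : 1 <= weight j.
Proof. by case: j => [|j] //=; rewrite ler1n. Qed.

Lemma weight_ge0 j : 0 <= weight j.
Proof. exact: le_trans ler01 (weight_ge1 j). Qed.

Lemma weight2 j : (0 < j)%N -> weight j = 2.
Proof. by case: j. Qed.

Lemma weighted_sumE y N : \sum_(0 <= n < N.+1) weight n * y n =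
  y 0%N + 2 * \sum_(1 <= n < N.+1) y n.
Proof.
rewrite big_ltn // mul1r mulr_sumr; congr (_ + _).
by rewrite !big_nat; apply: eq_bigr => n /andP[n0 _]; rewrite weight2.
Qed.

Lemma ell1_le_ge0 y C : ell1_le y C -> 0 <= C.
Proof. by move=> /(_ 0%N); rewrite big_geq. Qed.

Lemma ell1_le_wtrans y C D : C <= D -> ell1_le y C -> ell1_le y D.
Proof. by move=> CD yC n; exact: le_trans (yC n) CD. Qed.

Lemma ell1_le_coord y C n : ell1_le y C -> `|y n| <= C.
Proof.
move=> /(_ n.+1); rewrite big_nat_recr //=; apply: le_trans.
apply: ler_wpDl; last by rewrite ler_peMl // weight_ge1.
by apply: sumr_ge0 => i _; rewrite mulr_ge0 ?weight_ge0.
Qed.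

Lemma ell1_leD y z C D : ell1_le y C -> ell1_le z D ->
  ell1_le (fun n => y n + z n) (C + D).
Proof.
move=> yC zD n; apply: le_trans (lerD (yC n) (zD n)).
rewrite -big_split /=; apply: ler_sum => j _.
by rewrite -mulrDr ler_wpM2l ?weight_ge0 ?ler_normD.
Qed.

Lemma ell1_leN y C : ell1_le y C -> ell1_le (fun n => - y n) C.
Proof. by move=> yC n; under eq_bigr do rewrite normrN; exact: yC. Qed.

Lemma ell1_leB y z C D : ell1_le y C -> ell1_le z D ->
  ell1_le (fun n => y n - z n) (C + D).
Proof. by move=> yC zD; apply: ell1_leD => //; exact: ell1_leN. Qed.

Lemma ell1_le0 C : 0 <= C -> ell1_le (fun=> 0) C.
Proof. by move=> C0 n; rewrite big1 // => j _; rewrite normr0 mulr0. Qed.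

Lemma ell1_leW y z C : (forall n, `|y n| <= `|z n|) -> ell1_le z C ->
  ell1_le y C.
Proof.
move=> yz zC n; apply: le_trans (zC n); apply: ler_sum => j _.
by rewrite ler_wpM2l ?weight_ge0.
Qed.

(** Fatou's lemma for sequences: each partial sum passes to the limit. *)
Lemma ell1_le_lim (u : nat -> nat -> R) y C :
  (forall n, u k n @[k --> \oo] --> y n) -> (forall k, ell1_le (u k) C) ->
  ell1_le y C.
Proof.
move=> uy uC n; have cv : \sum_(0 <= j < n) weight j * `|u k j| @[k --> \oo]
    --> \sum_(0 <= j < n) weight j * `|y j|.
  elim: n => [|n IHn]; first by rewrite big_geq //; under eq_fun do rewrite big_geq //; exact: cvg_cst.
  rewrite big_nat_recr //=; under eq_fun do rewrite big_nat_recr //=.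
  by apply: cvgD => //; apply: cvgMl_tmp; apply: cvg_norm; exact: uy.
rewrite -(cvg_lim (@norm_hausdorff _ _) cv); apply: limr_le.
  by apply/cvg_ex; eexists; exact: cv.
by near=> k; exact: uC.
Unshelve. all: by end_near. Qed.

Lemma ell1_le_eq0 y : (forall e, 0 < e -> ell1_le y e) -> forall n, y n = 0.
Proof.
move=> ye n; apply/eqP; rewrite -normr_eq0 eq_le normr_ge0 andbT.
by apply/ler_addgt0Pr => e e0; rewrite add0r; apply: ell1_le_coord; exact: ye.
Qed.

End Ell1.

(** * Contractions of ell^1 *)

Section Contraction.
Context {R : realType}.
Implicit Types (y z : nat -> R).

Lemma cvg_scaled_expr (r C : R) : 0 <= r < 1 ->
  forall e : R, 0 < e -> exists k, r ^+ k * C < e.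
Proof.
move=> /andP[r0 r1] e e0.
have H : C * r ^+ k @[k --> \oo] --> (0 : R).
  by apply: cvg_geometric; rewrite ger0_norm.
have [k _ /(_ k (leqnn k)) /= Hk] := cvgr0_norm_lt _ H _ e0.
by exists k; rewrite mulrC; apply: le_lt_trans (ler_norm _) Hk.
Qed.

Variables (T : (nat -> R) -> nat -> R) (r g : R).
Hypothesis r01 : 0 <= r < 1.
Hypothesis T_contract : forall y z C, ell1 y -> ell1 z ->
  ell1_le (fun n => y n - z n) C -> ell1_le (fun n => T y n - T z n) (r * C).
Hypothesis T_start : ell1_le (T (fun=> 0)) g.

Let r0 : 0 <= r. Proof. by have /andP[] := r01. Qed.
Let r1 : r < 1. Proof. by have /andP[] := r01. Qed.
Let g0 : 0 <= g. Proof. exact: ell1_le_ge0 T_start. Qed.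
Let B (m : nat) : R := r ^+ m * (g / (1 - r)).
Let picard (m : nat) : nat -> R := iter m T (fun=> 0).

Lemma picard_step m : ell1 (picard m) /\
  ell1_le (fun n => picard m.+1 n - picard m n) (r ^+ m * g).
Proof.
elim: m => [|m [IH1 IH2]].
  split; first by exists 0; exact: ell1_le0.
  by rewrite expr0 mul1r /=; under eq_fun do rewrite subr0.
have ell : ell1 (picard m.+1).
  have [C yC] := IH1; exists (r ^+ m * g + C).
  by have := ell1_leD IH2 yC; under eq_fun do rewrite subrK.
by split=> //; rewrite exprS -mulrA; apply: T_contract.
Qed.

Lemma picard_cauchy m k :
  ell1_le (fun n => picard (m + k) n - picard m n) (B m).
Proof.
have r1' : 1 - r != 0 by rewrite subr_eq0 gt_eqF.
apply: (@ell1_le_wtrans _ _ (r ^+ m * (g * (1 - r ^+ k) / (1 - r)))).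
  rewrite ler_wpM2l ?exprn_ge0 // ler_pM2r ?invr_gt0 ?subr_gt0 //.
  by rewrite ler_piMr // lerBlDr lerDl exprn_ge0.
elim: k => [|k IH].
  rewrite addn0 expr0 subrr mulr0 mul0r mulr0.
  by under eq_fun do rewrite subrr; exact: ell1_le0.
have [_ H] := picard_step (m + k); have := ell1_leD H IH.
under eq_fun do rewrite addrA subrK.
rewrite -addnS; apply: ell1_le_wtrans; rewrite le_eqVlt; apply/orP; left.
by apply/eqP; rewrite exprD exprS; field.
Qed.

Let sol (n : nat) : R := limn (fun m => picard m n).

Lemma picard_cvg n : picard m n @[m --> \oo] --> sol n.
Proof.
suff : cvgn (fun m => picard m n) by [].
pose w m := picard m.+1 n - picard m n.
have E : (fun m => picard m n) = series w.
  apply/funext => m; rewrite /series /= /w (telescope_sumr (fun m => picard m n)) //.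
  by rewrite /= subr0.
rewrite E; apply: normed_cvg.
apply: (series_le_cvg _ _ _ (@is_cvg_geometric_series _ g r _)).
- by move=> m; rewrite normr_ge0.
- by move=> m; rewrite /geometric /= mulr_ge0 ?exprn_ge0.
- move=> m; rewrite /geometric /= mulrC.
  by have [_ H] := picard_step m; exact: (ell1_le_coord n H).
- by rewrite ger0_norm.
Qed.

Lemma picard_tail m : ell1_le (fun n => sol n - picard m n) (B m).
Proof.
apply: (@ell1_le_lim _ (fun k n => picard (m + k) n - picard m n)); last first.
  exact: picard_cauchy.
move=> n; apply: cvgB; last exact: cvg_cst.
under eq_fun do rewrite addnC.
by have := @picard_cvg n; rewrite -(@cvg_shiftn m _ (fun k => picard k n)); apply.
Qed.

(** Banach's fixed-point theorem in ell^1.  Completeness is replaced by the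
    pointwise convergence of the Picard iterates and by [ell1_le_lim], which
    keeps the geometric error bound in the limit. *)
Lemma ell1_fixpoint : exists y,
  [/\ ell1_le y (g / (1 - r)), T y = y & forall z, ell1 z -> T z = z -> z = y].
Proof.
have sol_le : ell1_le sol (g / (1 - r)).
  by have := picard_tail 0; rewrite /B expr0 mul1r; under eq_fun do rewrite subr0.
have sol_ell1 : ell1 sol by eexists; exact: sol_le.
have Tsol : T sol = sol.
  suff H : forall n, T sol n - sol n = 0.
    by apply/funext => n; apply/eqP; rewrite -subr_eq0 H.
  apply: ell1_le_eq0 => e e0.
  have [k Hk] := cvg_scaled_expr (g / (1 - r)) r01 (divr_gt0 e0 (ltr0n R 2)).
  have H1 := T_contract sol_ell1 (picard_step k).1 (picard_tail k).
  have := ell1_leB H1 (picard_tail k.+1).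
  under eq_fun do rewrite opprB addrA subrK.
  apply: ell1_le_wtrans; move: Hk; rewrite -/(B k) => Hk.
  have -> : B k.+1 = r * B k by rewrite /B exprS -mulrA.
  have Bk0 : 0 <= B k by rewrite mulr_ge0 ?exprn_ge0 ?divr_ge0 ?subr_ge0 // ltW.
  have : r * B k <= B k by rewrite ler_piMl // ltW.
  by move: Hk; lra.
exists sol; split=> // z zl Tz; apply/funext => n; apply/eqP.
rewrite -subr_eq0; apply/eqP; move: n.
have [C zC] : ell1 (fun n => z n - sol n).
  by have [C zC] := zl; eexists; exact: ell1_leB zC sol_le.
have H k : ell1_le (fun n => z n - sol n) (r ^+ k * C).
  elim: k => [|k IH]; first by rewrite expr0 mul1r.
  by have := T_contract zl sol_ell1 IH; rewrite Tz Tsol mulrA -exprS.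
apply: ell1_le_eq0 => e e0; have [k /ltW Hk] := cvg_scaled_expr C r01 e0.
exact: ell1_le_wtrans Hk (H k).
Qed.

End Contraction.

(** * Alternating sums of summable sequences *)

Section AlternatingSum.
Context {R : realType}.
Implicit Types (y z : nat -> R) (C : R).

Definition alt_sum y : R := limn (fun n => \sum_(1 <= l < n) (-1) ^+ l * y l).

Lemma alt_sum_cvg y C : (forall n, \sum_(1 <= l < n) `|y l| <= C) ->
  (\sum_(1 <= l < n) (-1) ^+ l * y l) @[n --> \oo] --> alt_sum y.
Proof.
move=> yC; suff : cvgn (fun n => \sum_(1 <= l < n) (-1) ^+ l * y l) by [].
pose u l : R := if l is 0 then 0 else (-1) ^+ l * y l.
have uE (f : nat -> R) n : f 0%N = 0 ->
    \sum_(0 <= l < n) f l = \sum_(1 <= l < n) f l.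
  move=> f0; case: n => [|n]; first by rewrite !big_geq.
  by rewrite big_ltn // f0 add0r.
have -> : (fun n => \sum_(1 <= l < n) (-1) ^+ l * y l) = series u.
  apply/funext => n; rewrite /series /= uE // !big_nat.
  by apply: eq_bigr => -[|l] /andP[].
apply: normed_cvg; apply: nondecreasing_is_cvgn.
  by apply/nondecreasing_seqP => n; rewrite /normed_series_of /series /= big_nat_recr //= lerDl.
exists C => _ [n _ <-]; apply: le_trans (yC n); rewrite /normed_series_of /series /=.
have := uE (fun l => `|u l|) n; rewrite normr0 => -> //; rewrite !big_nat.
rewrite le_eqVlt; apply/orP; left; apply/eqP.
by apply: eq_bigr => -[|l] /andP[] //= _ _; rewrite normrM normrX normrN1 expr1n mul1r.
Qed.

Lemma alt_sum_norm_le y C : (forall n, \sum_(1 <= l < n) `|y l| <= C) ->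
  `|alt_sum y| <= C.
Proof.
move=> yC; have cv : `|\sum_(1 <= l < n) (-1) ^+ l * y l| @[n --> \oo] --> `|alt_sum y|.
  by apply: cvg_norm; exact: alt_sum_cvg yC.
rewrite -(cvg_lim (@norm_hausdorff _ _) cv); apply: limr_le.
  by apply/cvg_ex; eexists; exact: cv.
near=> n; apply: le_trans (yC n); apply: le_trans (ler_norm_sum _ _ _) _.
by apply: ler_sum => l _; rewrite normrM normrX normrN1 expr1n mul1r.
Unshelve. all: by end_near. Qed.

Lemma ell1_le_alt y C : ell1_le y C -> forall n, \sum_(1 <= l < n) `|y l| <= C.
Proof.
move=> yC [|n]; first by rewrite big_geq // (ell1_le_ge0 yC).
apply: le_trans (yC n.+1); rewrite [leRHS]big_ltn // -[leLHS]add0r lerD ?mulr_ge0 //.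
by apply: ler_sum => l _; rewrite ler_peMl ?weight_ge1.
Qed.

Lemma ell1_alt_cvg y : ell1 y ->
  (\sum_(1 <= l < n) (-1) ^+ l * y l) @[n --> \oo] --> alt_sum y.
Proof. by move=> [C /ell1_le_alt]; exact: alt_sum_cvg. Qed.

Lemma alt_sumB y z : ell1 y -> ell1 z ->
  alt_sum (fun n => y n - z n) = alt_sum y - alt_sum z.
Proof.
move=> yl zl; have cv : (\sum_(1 <= l < n) (-1) ^+ l * y l) - (\sum_(1 <= l < n) (-1) ^+ l * z l)
    @[n --> \oo] --> alt_sum y - alt_sum z.
  by apply: cvgB; exact: ell1_alt_cvg.
rewrite -(cvg_lim (@norm_hausdorff _ _) cv) /alt_sum; congr (limn _).
by apply/funext => n; rewrite -sumrB; apply: eq_bigr => l _; rewrite mulrBr.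
Qed.

Lemma alt_sum_finite y N : (forall n, (N < n)%N -> y n = 0) ->
  alt_sum y = \sum_(1 <= l < N.+1) (-1) ^+ l * y l.
Proof.
move=> y0; apply: lim_near_cst; first exact: norm_hausdorff.
near=> n; have Nn : (N < n)%N by near: n; exact: nbhs_infty_gt.
rewrite (@big_cat_nat _ _ _ N.+1) //=.
rewrite [X in _ + X]big_nat [X in _ + X]big1 ?addr0 // => l /andP[Nl _].
by rewrite y0 ?mulr0.
Unshelve. all: by end_near. Qed.

End AlternatingSum.

(** * A block equation as a fixed-point problem *)

Section Blocks.
Context {R : realType}.
Implicit Types (y f : nat -> R) (m : R) (N : nat).

Lemma Lop0 m y : Lop m y 0 = y 0%N + 2 * alt_sum y.
Proof. by []. Qed.

Lemma LopS m y i :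
  Lop m y i.+1 = m * y i + (2 * i.+1)%:R * y i.+1 - m * y i.+2.
Proof. by []. Qed.

Definition vec N y : 'cV[R]_N.+1 := \col_i y i.
Definition trunc N y (n : nat) : R := if (n <= N)%N then y n else 0.
Definition tail N y (n : nat) : R := if (n <= N)%N then 0 else y n.

Lemma sum_delta N y (k : nat) : (forall n, (N < n)%N -> y n = 0) ->
  \sum_(j < N.+1) (k == j)%:R * y j = y k.
Proof.
move=> y0; have [Nk|kN] := ltnP N k.
  rewrite y0 // big1 // => j _; rewrite gtn_eqF ?mul0r //.
  exact: leq_trans (ltn_ord j) Nk.
rewrite (bigD1 (Ordinal (kN : (k < N.+1)%N))) //= eqxx mul1r big1 ?addr0 //.
by move=> j; rewrite -val_eqE /= eq_sym => /negPf ->; rewrite mul0r.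
Qed.

(** On sequences supported in [0 .. N], the first [N + 1] rows of the operator
    are the product by the truncated matrix. *)
Lemma Ltrunc_mul m N y : (forall n, (N < n)%N -> y n = 0) ->
  Ltrunc m N *m vec N y = vec N (Lop m y).
Proof.
move=> y0; apply/matrixP => i k; rewrite !mxE.
under eq_bigr do rewrite !mxE; case: i => -[|i] iN.
  rewrite Lop0 (alt_sum_finite y0) -(sum_delta 0 y0).
  transitivity (\sum_(j < N.+1) ((0%N == j)%:R * y j +
      2 * \sum_(1 <= l < N.+1) (-1) ^+ l * ((l == j)%:R * y j))).
    apply: eq_bigr => j _; rewrite Lop0 (@alt_sum_finite _ _ N).
      rewrite mulrDl -mulrA mulr_suml; congr (_ + 2 * _).
      by apply: eq_bigr => l _; rewrite mulrA.
    by move=> n Nn; rewrite gtn_eqF // (leq_trans _ Nn).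
  rewrite big_split /=; congr (_ + _); rewrite -mulr_sumr exchange_big /=.
  by congr (2 * _); apply: eq_bigr => l _; rewrite -mulr_sumr sum_delta.
rewrite LopS -(sum_delta i.+2 y0) -(sum_delta i.+1 y0).
rewrite -(sum_delta i y0) !mulr_sumr -big_split -sumrB /=.
by apply: eq_bigr => j _; rewrite !mulrDl mulNr !mulrA.
Qed.

(** Cutting [y] at [N] only affects row [0], which loses the alternating tail,
    and row [N], which loses its coupling to [y (N + 1)]; these are two different
    rows because [N > 0]. *)
Lemma Lop_trunc m N y (i : nat) : (0 < N)%N -> ell1 y -> (i <= N)%N ->
  Lop m (trunc N y) i =
  Lop m y i - (i == 0%N)%:R * (2 * alt_sum (tail N y)) + (i == N)%:R * (m * y N.+1).
Proof.
move=> N0 yl; have [C yC] := yl.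
have tll : ell1 (tail N y).
  exists C; apply: ell1_leW yC => n.
  by rewrite /tail; case: ifP => _ //; rewrite normr0.
have altE : alt_sum y = alt_sum (trunc N y) + alt_sum (tail N y).
  have -> : alt_sum (trunc N y) = alt_sum (fun n => y n - tail N y n).
    by congr alt_sum; apply/funext => n; rewrite /trunc /tail; case: leqP;
      rewrite ?subr0 ?subrr.
  by rewrite alt_sumB // subrK.
case: i => [|i] iN.
  by rewrite eqxx mul1r (ltn_eqF N0) mul0r addr0 !Lop0 altE (_ : trunc N y 0 = y 0%N) //; ring.
rewrite !LopS mul0r subr0 /trunc iN (ltnW iN).
have [->|iN1] := eqVneq i.+1 N; first by rewrite ltnn mul1r; ring.
have -> : (i.+1 < N)%N by rewrite ltn_neqAle iN1 iN.
by rewrite mul0r addr0.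
Qed.

Section Step.
Variables (m : R) (N : nat).
Hypotheses (N0 : (0 < N)%N) (Lu : Ltrunc m N \in unitmx).

(** The rows beyond [N], solved for their diagonal unknown. *)
Definition step_tail f y (j : nat) : R :=
  if (j <= N)%N then 0 else (f j - m * y j.-1 + m * y j.+1) / (2 * j)%:R.

(** The rows up to [N], solved by the inverse truncation after the two couplings
    of [Lop_trunc] have been moved to the right-hand side; row [0] uses the
    updated tail [step_tail f y] rather than that of [y]. *)
Definition step_head f y : 'cV[R]_N.+1 :=
  invmx (Ltrunc m N) *m vec N f - (2 * alt_sum (step_tail f y)) *: first_col m N
  + (m * y N.+1) *: last_col m N.

Definition step f y (n : nat) : R :=
  if (n <= N)%N then step_head f y (inord n) ord0 else step_tail f y n.

Lemma step_tailP f y : 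
  (forall j, (N < j)%N -> Lop m y j = f j) <-> step_tail f y = tail N y.
Proof.
split=> [H|H].
  apply/funext => j; rewrite /step_tail /tail; case: leqP => // Nj.
  have j0 : (2 * j)%:R != 0 :> R by rewrite pnatr_eq0 muln_eq0 /= -lt0n (leq_trans _ Nj).
  rewrite -(H _ Nj); case: j Nj j0 => // j _ j0; rewrite LopS /=.
  by apply: (mulIf j0); rewrite divfK //; ring.
move=> j Nj; have := congr1 (fun u => u j) H; rewrite /step_tail /tail leqNgt Nj /=.
have j0 : (2 * j)%:R != 0 :> R by rewrite pnatr_eq0 muln_eq0 /= -lt0n (leq_trans _ Nj).
case: j Nj j0 => // j _ j0 /(congr1 (fun x => x * (2 * j.+1)%:R)); rewrite divfK // LopS /=.
by rewrite (mulrC _ (2 * j.+1)%:R) => <-; ring.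
Qed.

Lemma step_headE f y : step_head f y = invmx (Ltrunc m N) *m
  vec N (fun i => f i - (i == 0%N)%:R * (2 * alt_sum (step_tail f y))
    + (i == N)%:R * (m * y N.+1)).
Proof.
rewrite /step_head /first_col /last_col !colE.
rewrite !scalemxAr -mulmxN -!mulmxDr; congr (_ *m _).
apply/matrixP => i k; rewrite !mxE !ord1 !andbT -!val_eqE /=.
by rewrite mulrC [X in _ + X]mulrC.
Qed.

(** At a fixed point the updated tail is the tail of [y], so that the first rows
    hold if and only if the head is the one given by the inverse truncation. *)
Lemma step_fixP f y : ell1 y -> (step f y = y <-> Lop m y = f).
Proof.
move=> yl; have trE : Ltrunc m N *m vec N y = vec N (fun i =>
    Lop m y i - (i == 0%N)%:R * (2 * alt_sum (tail N y)) + (i == N)%:R * (m * y N.+1)).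
  rewrite -[vec N y](_ : vec N (trunc N y) = _).
    rewrite Ltrunc_mul; last by move=> n Nn; rewrite /trunc leqNgt Nn.
    by apply/matrixP => i k; rewrite !mxE Lop_trunc // -ltnS.
  by apply/matrixP => i k; rewrite !mxE /trunc -ltnS ltn_ord.
split=> [H|H].
  have hi j : (N < j)%N -> Lop m y j = f j.
    move: j; apply/step_tailP/funext => j; rewrite -{2}H /tail /step.
    by rewrite /step_tail; case: leqP.
  have /step_tailP tE := hi.
  apply/funext => j; have [jN|/hi //] := leqP j N.
  have : vec N y = step_head f y.
    apply/matrixP => i k; rewrite mxE -{1}H /step -ltnS ltn_ord inord_val.
    by rewrite (ord1 k).
  rewrite step_headE => /(congr1 (mulmx (Ltrunc m N))).
  rewrite mulKVmx // trE => /matrixP/(_ (inord j) ord0).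
  rewrite !mxE inordK // tE => /eqP.
  by rewrite (inj_eq (addIr _)) (inj_eq (addIr _)) => /eqP.
have tE : step_tail f y = tail N y by apply/step_tailP => j _; rewrite H.
apply/funext => n; rewrite /step; case: leqP => nN; last by rewrite tE /tail leqNgt nN.
have -> : step_head f y = vec N y.
  rewrite step_headE tE -[RHS](mulKmx Lu) trE; congr (_ *m _).
  by rewrite H.
by rewrite mxE inordK.
Qed.

End Step.
End Blocks.

(** * The norms of vectors and matrices *)

Section MatrixNorms.
Context {R : realType} {N : nat}.
Implicit Types (v w : 'cV[R]_N.+1) (A : 'M[R]_N.+1).

Lemma ell1_vnormE v : ell1_vnorm v = \sum_(i < N.+1) weight i * `|v i ord0|.
Proof.
rewrite /ell1_vnorm [RHS](bigD1 ord0) //= mulr_sumr; congr (_ + _).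
  by rewrite mul1r.
by apply: eq_bigr => i; rewrite -val_eqE /=; case: (nat_of_ord i).
Qed.

Lemma ell1_vnorm_ge0 v : 0 <= ell1_vnorm v.
Proof.
by rewrite ell1_vnormE; apply: sumr_ge0 => i _; rewrite mulr_ge0 ?weight_ge0.
Qed.

Lemma ell1_vnormD v w : ell1_vnorm (v + w) <= ell1_vnorm v + ell1_vnorm w.
Proof.
rewrite !ell1_vnormE -big_split /=; apply: ler_sum => i _.
by rewrite mxE -mulrDr ler_wpM2l ?weight_ge0 ?ler_normD.
Qed.

Lemma ell1_vnormZ a v : ell1_vnorm (a *: v) = `|a| * ell1_vnorm v.
Proof.
rewrite !ell1_vnormE mulr_sumr; apply: eq_bigr => i _.
by rewrite mxE normrM mulrCA.
Qed.

Lemma ell1_vnorm0 : ell1_vnorm (0 : 'cV[R]_N.+1) = 0.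
Proof. by rewrite -(scale0r 0) ell1_vnormZ normr0 mul0r. Qed.

Lemma ell1_vnorm_sum I (r : seq I) (F : I -> 'cV[R]_N.+1) :
  ell1_vnorm (\sum_(i <- r) F i) <= \sum_(i <- r) ell1_vnorm (F i).
Proof.
elim/big_rec2: _ => [|i x v _ H]; first by rewrite ell1_vnorm0.
by apply: le_trans (ell1_vnormD _ _) _; rewrite lerD2l.
Qed.

Lemma mulmx_cols A v : A *m v = \sum_j v j ord0 *: col j A.
Proof.
apply/matrixP => i k; rewrite mxE summxE; apply: eq_bigr => j _.
by rewrite !mxE (ord1 k) mulrC.
Qed.

Lemma ell1_vnorm_mulmx A v (C : R) : 0 <= C ->
  (forall j : 'I_N.+1, ell1_vnorm (col j A) <= C * weight j) ->
  ell1_vnorm (A *m v) <= C * ell1_vnorm v.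
Proof.
move=> C0 AC; rewrite mulmx_cols; apply: le_trans (ell1_vnorm_sum _ _) _.
rewrite [X in C * X]ell1_vnormE mulr_sumr; apply: ler_sum => j _.
rewrite ell1_vnormZ mulrA [leRHS]mulrC.
by apply: ler_wpM2l => //; exact: AC.
Qed.

(* The operator norm of [A], before [fine]. *)
Let unit_sup A := ereal_sup [set (ell1_vnorm (A *m v))%:E |
  v in [set v : 'cV[R]_N.+1 | ((ell1_vnorm v)%:E <= 1)%E]].

Lemma unit_sup_le A (C : R) : 0 <= C ->
  (forall j : 'I_N.+1, ell1_vnorm (col j A) <= C * weight j) ->
  (unit_sup A <= C%:E)%E.
Proof.
move=> C0 AC; apply: ge_ereal_sup => _ [v v1 <-]; rewrite lee_fin.
apply: le_trans (ell1_vnorm_mulmx v C0 AC) _.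
by rewrite ler_piMr //; move: v1; rewrite /= lee_fin.
Qed.

Lemma unit_sup_fin A : unit_sup A \is a fin_num.
Proof.
rewrite ge0_fin_numE; last first.
  apply: ereal_sup_ubound; exists 0; last by rewrite mulmx0 ell1_vnorm0.
  by rewrite /= ell1_vnorm0 lee_fin.
apply: (@le_lt_trans _ _ (\sum_j ell1_vnorm (col j A))%:E); last exact: ltry.
apply: unit_sup_le; first by apply: sumr_ge0 => j _; exact: ell1_vnorm_ge0.
move=> j; rewrite -[leLHS]mulr1; apply: ler_pM => //.
- exact: ell1_vnorm_ge0.
- rewrite [leRHS](bigD1 j) //= lerDl; apply: sumr_ge0 => i _.
  exact: ell1_vnorm_ge0.
- exact: weight_ge1.
Qed.

(** The supremum that defines the norm is finite, so [fine] does not change it;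
    the inequality then follows by scaling [v] to the unit sphere. *)
Lemma mx_op_normP A v : ell1_vnorm (A *m v) <= mx_op_norm A * ell1_vnorm v.
Proof.
have [v0|v0] := eqVneq (ell1_vnorm v) 0.
  rewrite v0 mulr0; have -> : v = 0.
    apply/matrixP => i k; rewrite (ord1 k) mxE; apply/eqP; rewrite -normr_eq0.
    apply/eqP; apply/le_anti; rewrite normr_ge0 andbT -v0 ell1_vnormE.
    rewrite (bigD1 i) //=; apply: ler_wpDr.
      by apply: sumr_ge0 => j _; rewrite mulr_ge0 ?weight_ge0.
    by rewrite ler_peMl ?weight_ge1.
  by rewrite mulmx0 ell1_vnorm0.
have vp : 0 < ell1_vnorm v by rewrite lt_neqAle eq_sym v0 ell1_vnorm_ge0.
rewrite -ler_pdivrMr // -lee_fin /mx_op_norm /op_norm -/(unit_sup A).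
rewrite fineK ?unit_sup_fin //; apply: ereal_sup_ubound.
exists ((ell1_vnorm v)^-1 *: v); last first.
  by rewrite -scalemxAr ell1_vnormZ ger0_norm ?invr_ge0 ?ltW // mulrC.
by rewrite /= lee_fin ell1_vnormZ ger0_norm ?invr_ge0 ?(ltW vp) // mulVf.
Qed.

(** For ell^1 norms, only the columns matter. *)
Lemma mx_op_norm_le A (C : R) : 0 <= C ->
  (forall j : 'I_N.+1, ell1_vnorm (col j A) <= C * weight j) ->
  mx_op_norm A <= C.
Proof.
move=> C0 AC; rewrite -lee_fin /mx_op_norm /op_norm -/(unit_sup A).
by rewrite fineK ?unit_sup_fin //; exact: unit_sup_le.
Qed.

End MatrixNorms.

(** * The norm of the approximate inverse *)

Section StepBounds.
Context {R : realType}.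
Implicit Types (y f : nat -> R) (m : R) (N : nat).
Variables (m : R) (N : nat).

Lemma vnorm_vec y : ell1_vnorm (vec N y) = \sum_(0 <= j < N.+1) weight j * `|y j|.
Proof.
by rewrite ell1_vnormE big_mkord; apply: eq_bigr => i _; rewrite mxE.
Qed.

Lemma ell1_le_split y C n : ell1_le y C ->
  ell1_vnorm (vec N y) + 2 * (\sum_(N.+1 <= j < n) `|y j|) <= C.
Proof.
move=> yC; have [nN|Nn] := leqP n N.+1.
  by rewrite [X in 2 * X]big_geq // mulr0 addr0 vnorm_vec; exact: yC.
apply: le_trans (yC n); rewrite vnorm_vec [leRHS](@big_cat_nat _ _ _ N.+1) //=; last exact: ltnW.
rewrite lerD2l mulr_sumr !big_nat; apply: ler_sum => j /andP[Nj _].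
by rewrite weight2 // (leq_trans _ Nj).
Qed.

Lemma ell1_le_step f y C :
  (forall n, ell1_vnorm (step_head m N f y)
     + 2 * (\sum_(N.+1 <= j < n) `|step_tail m N f y j|) <= C) ->
  ell1_le (step m N f y) C.
Proof.
move=> H n; apply: le_trans (H n).
have headE : ell1_vnorm (step_head m N f y) =
    \sum_(0 <= j < N.+1) weight j * `|step m N f y j|.
  rewrite ell1_vnormE big_mkord; apply: eq_bigr => i _.
  by rewrite /step -ltnS ltn_ord inord_val.
have p k : 0 <= weight k * `|step m N f y k| by rewrite mulr_ge0 ?weight_ge0.
rewrite headE; have [nN|Nn] := leqP n N.+1.
  rewrite [X in 2 * X]big_geq // mulr0 addr0.
  rewrite [leRHS](@big_cat_nat _ _ _ n) //= lerDl.
  by apply: sumr_ge0 => j _; exact: p.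
rewrite [leLHS](@big_cat_nat _ _ _ N.+1) //=; last exact: ltnW.
rewrite lerD2l mulr_sumr !big_nat; apply: ler_sum => j /andP[Nj _].
by rewrite /step leqNgt Nj /= weight2 // (leq_trans _ Nj).
Qed.

Lemma step_tail_alt_partial f y n : (N < n)%N ->
  \sum_(1 <= l < n) (-1) ^+ l * step_tail m N f y l =
  \sum_(N.+1 <= l < n) (-1) ^+ l * step_tail m N f y l.
Proof.
move=> Nn; rewrite (@big_cat_nat _ _ _ N.+1) //= [X in X + _]big_nat.
rewrite [X in X + _]big1 ?add0r // => l /andP[_].
by rewrite ltnS /step_tail => ->; rewrite mulr0.
Qed.

Lemma step_tail_abs_partial f y n :
  \sum_(1 <= l < n) `|step_tail m N f y l| <=
  \sum_(N.+1 <= l < n) `|step_tail m N f y l|.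
Proof.
have [nN|Nn] := leqP n N.+1.
  rewrite [leRHS]big_geq // big_nat big1 // => l /andP[_ ln].
  by rewrite /step_tail -ltnS (leq_trans ln nN) normr0.
rewrite (@big_cat_nat _ _ _ N.+1) //=; last exact: ltnW.
rewrite gerDr big_nat big1 // => l /andP[_ ln].
by rewrite /step_tail -ltnS ln normr0.
Qed.

(** The map [f |-> step f 0] acts on the entries up to [N] by the inverse
    truncation and sends the unit sequence [e_j], [j > N], to
    [(e_j - 2 (-1) ^ j c_1) / (2 j)] with [c_1] the first column.  Relative to the
    weight [2] of [e_j], the latter has norm [(1 + |c_1|) / (2 j)], largest for
    [j = N + 1], where it is the second term of [beta]. *)
Lemma step_source_bound f C : ell1_le f C ->
  ell1_le (step m N f (fun=> 0)) (beta m N * C).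
Proof.
move=> fC; set c := ell1_vnorm (first_col m N); set vf := ell1_vnorm (vec N f).
have c0 : 0 <= c := ell1_vnorm_ge0 _.
have vf0 : 0 <= vf := ell1_vnorm_ge0 _.
have vfC : vf <= C.
  by have := ell1_le_split 0 fC; rewrite [X in 2 * X]big_geq // mulr0 addr0.
set t := step_tail m N f (fun=> 0).
pose b := (2 * N.+1%:R)^-1 : R.
have b0 : 0 <= b by rewrite invr_ge0 mulr_ge0.
have tb n : 2 * (\sum_(N.+1 <= j < n) `|t j|) <= b * (C - vf).
  have h : 2 * (\sum_(N.+1 <= j < n) `|f j|) <= C - vf.
    by rewrite lerBrDl; exact: ell1_le_split.
  apply: le_trans (_ : b * (2 * (\sum_(N.+1 <= j < n) `|f j|)) <= _); last first.
    by rewrite ler_wpM2l.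
  rewrite mulrCA ler_pM2l // mulr_sumr !big_nat; apply: ler_sum => j /andP[Nj _].
  rewrite /t /step_tail leqNgt Nj /= mulr0 subr0 addr0 normrM mulrC.
  apply: ler_wpM2r => //; rewrite normfV ger0_norm // /b -natrM.
  rewrite lef_pV2 ?posrE ?ltr0n ?muln_gt0 //= ?(leq_trans _ Nj) //.
  by rewrite ler_nat leq_mul2l.
have alt2 : 2 * `|alt_sum t| <= b * (C - vf).
  suff : `|alt_sum t| <= b * (C - vf) / 2 by lra.
  apply: alt_sum_norm_le => n; have := tb n; have := step_tail_abs_partial f (fun=> 0) n.
  rewrite -/t; lra.
apply: ell1_le_step => n; have := tb n; rewrite -/t => tn.
have hd : ell1_vnorm (step_head m N f (fun=> 0)) <=
    mx_op_norm (invmx (Ltrunc m N)) * vf + b * (C - vf) * c.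
  rewrite /step_head mulr0 scale0r addr0 -/t -scaleNr.
  apply: le_trans (ell1_vnormD _ _) _; apply: lerD; first exact: mx_op_normP.
  rewrite ell1_vnormZ normrN normrM ger0_norm // -/c.
  by apply: ler_wpM2r.
have B1 : mx_op_norm (invmx (Ltrunc m N)) <= beta m N by rewrite /beta le_max lexx.
have B2 : b * (c + 1) <= beta m N by rewrite /beta le_max lexx orbT.
have : mx_op_norm (invmx (Ltrunc m N)) * vf <= beta m N * vf by rewrite ler_wpM2r.
have : b * (c + 1) * (C - vf) <= beta m N * (C - vf) by rewrite ler_wpM2r ?subr_ge0.
lra.
Qed.

End StepBounds.

(** * The contraction ratio of the fixed-point map *)

Section StepContraction.
Context {R : realType}.
Implicit Types (y f : nat -> R).
Variables (m : R) (N : nat).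
Hypotheses (N0 : (0 < N)%N) (Nev : ~~ odd N).

(* The reciprocals of the indices from [N + 1] on. *)
Let a (i : nat) : R := (N.+1 + i)%:R^-1.

Let a_ge0 i : 0 <= a i. Proof. by rewrite invr_ge0. Qed.
Let a_le i j : (i <= j)%N -> a j <= a i.
Proof. by move=> ij; rewrite lef_pV2 ?posrE ?ltr0n // ler_nat leq_add2l. Qed.

Let t y := step_tail m N (fun=> 0) y.

Let tE y k : 2 * t y (N.+1 + k) = m * (y (N.+2 + k)%N - y (N + k)%N) * a k.
Proof.
rewrite /t /step_tail leqNgt ltn_addr //= addSn /= /a addSn natrM.
by rewrite ?addSn invfM; set i := (N + k).+1%:R^-1; field.
Qed.

(** The alternating sum of the updated tail, regrouped by the entries of [y]:
    entry [j] receives [1 / (j - 1)] from row [j - 1] and [- 1 / (j + 1)] from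
    row [j + 1], up to sign, except for [j = N] and [j = N + 1], which only have
    one neighbouring row beyond [N].  At the other end, [alt_boundary] is what
    the last two rows of the partial sum leave over; it tends to [0]. *)
Definition alt_main y k : R :=
  y N * a 0 - y N.+1 * a 1
  + \sum_(0 <= i < k) (-1) ^+ i.+1 * y (N.+2 + i)%N * (a i - a i.+2).

Definition alt_boundary y k : R :=
  (-1) ^+ k.+1 * y (N.+2 + k)%N * a k + (-1) ^+ k * y (N.+1 + k)%N * a k.+1.

Let signN k : (-1) ^+ (N.+1 + k) = (-1) ^+ k.+1 :> R.
Proof. by rewrite addSnnS exprD -signr_odd (negPf Nev) expr0 mul1r. Qed.

Lemma step_tail_alt_sum y k :
  2 * (\sum_(N.+1 <= l < N.+2 + k) (-1) ^+ l * t y l) =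
  m * (alt_main y k + alt_boundary y k).
Proof.
elim: k => [|k IH].
  rewrite addn0 big_nat1 mulrCA -[X in t y X]addn0 tE !addn0.
  rewrite -[X in (-1) ^+ X]addn0 signN /alt_main /alt_boundary big_geq // !addn0.
  by rewrite expr0 expr1; ring.
rewrite addnS big_nat_recr /=; last by lia.
rewrite mulrDr IH mulrCA (_ : (N.+2 + k)%N = (N.+1 + k.+1)%N); last by rewrite addnS.
rewrite tE signN /alt_main /alt_boundary big_nat_recr //=.
have -> : (N + k.+1)%N = (N.+1 + k)%N by rewrite addnS.
have -> : (N.+1 + k.+1)%N = (N.+2 + k)%N by rewrite addnS.
by rewrite !exprS; ring.
Qed.

Lemma step_tail_abs_sum y k :
  2 * (\sum_(N.+1 <= l < N.+2 + k) `|t y l|) <=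
  `|m| * (`|y N| * a 0 + `|y N.+1| * a 1
    + \sum_(0 <= i < k.+1) `|y (N.+2 + i)%N| * (a i + a i.+2)).
Proof.
have tn l : 2 * `|t y (N.+1 + l)%N| <=
    `|m| * (`|y (N.+2 + l)%N| * a l + `|y (N + l)%N| * a l).
  rewrite -[2]ger0_norm // -normrM tE !normrM (ger0_norm (a_ge0 l)) -mulrA.
  by rewrite ler_wpM2l // -mulrDl ler_wpM2r // ler_normB.
suff H : 2 * (\sum_(N.+1 <= l < N.+2 + k) `|t y l|) +
    `|m| * (`|y (N.+1 + k)%N| * a k.+1 + `|y (N.+2 + k)%N| * a k.+2) <=
  `|m| * (`|y N| * a 0 + `|y N.+1| * a 1
    + \sum_(0 <= i < k.+1) `|y (N.+2 + i)%N| * (a i + a i.+2)).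
  by apply: le_trans H; rewrite lerDl !(mulr_ge0, addr_ge0).
elim: k => [|k IH].
  by have := tn 0; rewrite !addn0 !big_nat1 !addn0; lra.
rewrite (_ : (N.+2 + k.+1)%N = (N.+2 + k).+1); last by rewrite addnS.
rewrite [X in 2 * X]big_nat_recr; last by lia.
rewrite [X in _ <= _ * (_ + X)]big_nat_recr //.
have := tn k.+1.
have -> : (N + k.+1)%N = (N.+1 + k)%N by rewrite addnS.
have -> : (N.+1 + k.+1)%N = (N.+2 + k)%N by rewrite addnS.
rewrite (_ : (N.+2 + k.+1)%N = (N.+2 + k).+1); last by rewrite addnS.
by move: IH => /= IH H; lra.
Qed.

Lemma alt_boundary_cvg0 y C : ell1_le y C ->
  alt_boundary y k @[k --> \oo] --> (0 : R).
Proof.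
move=> yC; have h0 : 2 * C * @harmonic R k @[k --> \oo] --> (0 : R).
  by rewrite -[X in _ --> X](mulr0 (2 * C)); apply: cvgMl_tmp; exact: cvg_harmonic.
apply/norm_cvg0P; apply: (squeeze_cvgr _ (cvg_cst 0) h0).
near=> k; rewrite normr_ge0 /=; apply: le_trans (ler_normD _ _) _.
have ak i : (k <= i)%N -> a i <= k.+1%:R^-1.
  by move=> ki; rewrite lef_pV2 ?posrE ?ltr0n // ler_nat; lia.
have C0 := ell1_le_ge0 yC.
have hb n i : (k <= i)%N -> `|y n| * a i <= C * k.+1%:R^-1.
  by move=> ki; apply: ler_pM => //; [exact: ell1_le_coord|exact: ak].
rewrite !normrM !normrX !normrN1 !expr1n !mul1r !(ger0_norm (a_ge0 _)) /harmonic /=.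
have := hb (N.+2 + k)%N k (leqnn k); have := hb (N.+1 + k)%N k.+1 (leqnSn k).
rewrite -mulrA; set x := C / _; lra.
Unshelve. all: by end_near. Qed.

Lemma ell1_le_from y C k : ell1_le y C ->
  2 * (`|y N| + `|y N.+1| + \sum_(0 <= i < k) `|y (N.+2 + i)%N|) <= C.
Proof.
move=> yC; apply: le_trans (yC (N.+2 + k)%N).
set n := (N.+2 + k)%N; have Nn : (N.+2 <= n)%N by rewrite /n; lia.
rewrite (@big_cat_nat _ _ _ N _ _ _ _ (leq0n N) (ltnW (ltnW Nn))) /=.
apply: ler_wpDl; first by apply: sumr_ge0 => j _; rewrite mulr_ge0 ?weight_ge0.
rewrite [leRHS]big_ltn ?(ltnW Nn) // [X in _ <= _ + X]big_ltn //.
rewrite !weight2 // !mulrDr -addrA !lerD2l mulr_sumr.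
rewrite -[X in \sum_(X <= _ < _) weight _ * _]add0n /n [(N.+2 + k)%N]addnC.
rewrite big_addn addnK !big_nat; apply: ler_sum => i _.
by rewrite [(i + N.+2)%N]addnC weight2.
Qed.

(** Regrouped by the entries of [y], the image is [m] times a combination of
    columns: [y N] has factor at most [rho1], [y (N + 1)] has [rho2], because
    the last column and the first one add up, and the later entries have at most
    [rho3], because there the coefficients of the first column nearly cancel.
    All these entries have weight [2], whence the factor [|m| / 2] of [rho].
    The estimate is first made with partial alternating sums. *)
Lemma step_contraction y C : ell1_le y C ->
  ell1_le (step m N (fun=> 0) y) (rho m N * C).
Proof.
move=> yC; set c1 := first_col m N; set cN := last_col m N.
have c0 : 0 <= ell1_vnorm c1 := ell1_vnorm_ge0 _.
set c := ell1_vnorm c1 in c0 *; set M := Num.max (rho1 m N) (Num.max (rho2 m N) (rho3 m N)).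
have sa i : a i.+2 <= a i by apply: a_le; rewrite ltnW.
have y_le k : `|y N| * rho1 m N + `|y N.+1| * rho2 m N
    + \sum_(0 <= i < k) `|y (N.+2 + i)%N| * rho3 m N <= M * (C / 2).
  have h1 : rho1 m N <= M by rewrite le_max lexx.
  have h2 : rho2 m N <= M by rewrite !le_max lexx orbT.
  have h3 : rho3 m N <= M by rewrite !le_max lexx !orbT.
  have M0 : 0 <= M.
    by apply: le_trans h1; rewrite /rho1 mulr_ge0 ?invr_ge0 ?ler0n // addr_ge0 ?ell1_vnorm_ge0.
  have : `|y N| + `|y N.+1| + \sum_(0 <= i < k) `|y (N.+2 + i)%N| <= C / 2.
    by have := ell1_le_from k yC; lra.
  move=> /(ler_wpM2l M0); apply: le_trans.
  rewrite [leRHS]mulrDr [X in _ <= X + _]mulrDr mulr_sumr.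
  apply: lerD; first by apply: lerD; rewrite mulrC; apply: ler_wpM2r.
  by apply: ler_sum => i _; rewrite mulrC; apply: ler_wpM2r.
have rho3_ge i : c * (a i - a i.+2) + (a i + a i.+2) <= rho3 m N.
  have a_diff k : a k - a k.+2 = 2 * (a k * a k.+2).
    rewrite /a (_ : (N.+1 + k.+2)%:R = (N.+1 + k)%:R + 2 :> R); last first.
      by rewrite -natrD; congr _%:R; lia.
    have x0 : 0 < (N.+1 + k)%:R :> R by rewrite ltr0n.
    set x := (N.+1 + k)%:R in x0 *; have x2 : 0 < x + 2 by rewrite addr_gt0.
    by field; rewrite !gt_eqF.
  rewrite /rho3 -/c1 -/c; have -> : 2 / (N.+1%:R * N.+3%:R) = 2 * (a 0 * a 2) :> R.
    by rewrite /a addn0 addn2 invfM.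
  have -> : N.+1%:R^-1 = a 0 by rewrite /a addn0.
  have -> : N.+3%:R^-1 = a 2 by rewrite /a addn2.
  have : a i * a i.+2 <= a 0 * a 2 by rewrite ler_pM // a_le.
  move=> /(ler_wpM2l c0); rewrite a_diff.
  by have := @a_le 0 i isT; have := @a_le 2 i.+2 isT; lra.
have head_le k : ell1_vnorm ((m * y N.+1) *: cN - (m * alt_main y k) *: c1)
    + 2 * (\sum_(N.+1 <= l < N.+2 + k) `|t y l|) <= rho m N * C.
  set v := ell1_vnorm (cN + N.+2%:R^-1 *: c1).
  pose p i := `|y (N.+2 + i)%N|.
  have split_head : (m * y N.+1) *: cN - (m * alt_main y k) *: c1 =
      m *: (y N.+1 *: (cN + N.+2%:R^-1 *: c1) + (- (y N * a 0
        + \sum_(0 <= i < k) (-1) ^+ i.+1 * y (N.+2 + i)%N * (a i - a i.+2))) *: c1).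
    rewrite /alt_main (_ : a 1 = N.+2%:R^-1); last by rewrite /a addn1.
    have lin (u w : 'cV[R]_N.+1) p1 q1 s1 x1 : (m * p1) *: w - (m * (q1 - p1 * x1 + s1)) *: u
        = m *: (p1 *: (w + x1 *: u) + (- (q1 + s1)) *: u).
      by apply/matrixP => i j; rewrite !mxE; ring.
    exact: lin.
  have head : ell1_vnorm ((m * y N.+1) *: cN - (m * alt_main y k) *: c1) <=
      `|m| * (`|y N.+1| * v + (`|y N| * a 0 + \sum_(0 <= i < k.+1) p i * (a i - a i.+2)) * c).
    rewrite split_head ell1_vnormZ ler_wpM2l //.
    apply: le_trans (ell1_vnormD _ _) _; rewrite !ell1_vnormZ lerD2l.
    rewrite normrN ler_wpM2r //; apply: le_trans (ler_normD _ _) _.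
    rewrite normrM (ger0_norm (a_ge0 0)) lerD2l.
    apply: le_trans (ler_norm_sum _ _ _) _.
    have d i : 0 <= a i - a i.+2 by rewrite subr_ge0.
    rewrite [leRHS]big_nat_recr //=; apply: ler_wpDr; first by apply: mulr_ge0; [exact: normr_ge0 | exact: d].
    by apply: ler_sum => i _; rewrite !normrM normrX normrN1 expr1n mul1r (ger0_norm (d i)).
  apply: le_trans (lerD head (step_tail_abs_sum y k)) _.
  rewrite -mulrDr.
  have -> : rho m N * C = `|m| * (M * (C / 2)) by rewrite /rho -/M; field.
  apply: ler_wpM2l => //; apply: le_trans (y_le k.+1).
  have -> : rho1 m N = a 0 * (c + 1) by rewrite /rho1 /a addn0.
  have -> : rho2 m N = v + a 1 by rewrite /rho2 /a addn1.
  have : \sum_(0 <= i < k.+1) p i * (c * (a i - a i.+2) + (a i + a i.+2)) <=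
      \sum_(0 <= i < k.+1) p i * rho3 m N.
    by apply: ler_sum => i _; apply: ler_wpM2l; [exact: normr_ge0 | exact: rho3_ge].
  have -> : \sum_(0 <= i < k.+1) p i * (c * (a i - a i.+2) + (a i + a i.+2)) =
      (\sum_(0 <= i < k.+1) p i * (a i - a i.+2)) * c
      + \sum_(0 <= i < k.+1) p i * (a i + a i.+2).
    by rewrite mulr_suml -big_split /=; apply: eq_bigr => i _; ring.
  rewrite /p; lra.
have t_mono n k : (n <= k)%N ->
    \sum_(N.+1 <= l < n) `|t y l| <= \sum_(N.+1 <= l < N.+2 + k) `|t y l|.
  move=> nk; have [nN|Nn] := leqP n N.+1.
    by rewrite big_geq //; apply: sumr_ge0.
  have nk2 : (n <= N.+2 + k)%N by lia.
  by rewrite [leRHS](@big_cat_nat _ _ _ n _ _ _ _ (ltnW Nn) nk2) /= lerDl sumr_ge0.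
have t_bound n : \sum_(1 <= l < n) `|t y l| <= rho m N * C.
  have := head_le n; have := step_tail_abs_partial m N (fun=> 0) y n.
  have := t_mono n n (leqnn n); have := ell1_vnorm_ge0 ((m * y N.+1) *: cN - (m * alt_main y n) *: c1).
  have : 0 <= \sum_(1 <= l < n) `|t y l| by apply: sumr_ge0.
  rewrite -/(t y); lra.
have cv : m * alt_main y k @[k --> \oo] --> 2 * alt_sum (t y).
  have -> : (fun k => m * alt_main y k) = (fun k =>
      2 * (\sum_(1 <= l < k + N.+2) (-1) ^+ l * t y l) - m * alt_boundary y k).
    apply/funext => k; rewrite step_tail_alt_partial; last by lia.
    by rewrite addnC step_tail_alt_sum; ring.
  rewrite -[X in _ --> X]subr0 -[X in _ --> (_ - X)](mulr0 m); apply: cvgB; apply: cvgMl_tmp.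
    have := @alt_sum_cvg _ _ _ t_bound.
    by rewrite -(@cvg_shiftn N.+2 _ (fun k => \sum_(1 <= l < k) (-1) ^+ l * t y l)); apply.
  exact: alt_boundary_cvg0 yC.
apply: ell1_le_step => n; rewrite -/(t y).
apply/ler_addgt0Pr => e e0.
rewrite /step_head (_ : vec N (fun=> 0) = 0); last by apply/matrixP => i j; rewrite !mxE.
rewrite mulmx0 add0r -/c1 -/cN -/(t y).
have e1 : 0 < e / (ell1_vnorm c1 + 1) by rewrite divr_gt0 // ltr_wpDl.
(* For [k] large, replacing the alternating sum by its main part costs at most [e]. *)
have [K _ HK] := (cvgrPdist_lt _ _).1 cv _ e1.
have {HK} Hk := ltW (HK (maxn K n) (leq_maxl _ _)).
set k := maxn K n in Hk; have := head_le k.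
have nk : 2 * (\sum_(N.+1 <= l < n) `|t y l|) <= 2 * (\sum_(N.+1 <= l < N.+2 + k) `|t y l|).
  by rewrite ler_pM2l // t_mono // leq_maxr.
have : ell1_vnorm (- (2 * alt_sum (t y)) *: c1 + (m * y N.+1) *: cN) <=
   ell1_vnorm ((m * y N.+1) *: cN - (m * alt_main y k) *: c1) + e.
  have -> : - (2 * alt_sum (t y)) *: c1 + (m * y N.+1) *: cN =
    ((m * y N.+1) *: cN - (m * alt_main y k) *: c1)
     + (m * alt_main y k - 2 * alt_sum (t y)) *: c1.
    by rewrite scalerBl addrA subrK scaleNr addrC.
  apply: le_trans (ell1_vnormD _ _) _; rewrite lerD2l ell1_vnormZ distrC.
  apply: le_trans (ler_wpM2r c0 Hk) _; rewrite -mulrA ler_piMr ?(ltW e0) //.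
  by rewrite mulrC ler_pdivrMr ?ltr_wpDl // mul1r lerDl.
rewrite scaleNr; move: nk; lra.
Qed.

End StepContraction.

(** * Inverting a block with a good truncation *)

Section BlockInverse.
Context {R : realType}.
Implicit Types (y z f : nat -> R).

(** [Lop m] is bijective on ell^1 (in the sense that every [f] has exactly one
    preimage in ell^1) and its inverse has norm at most [K]. *)
Definition block_bound (m K : R) := forall f C, ell1_le f C ->
  exists y, [/\ ell1_le y (K * C), Lop m y = f &
    forall z, ell1 z -> Lop m z = f -> z = y].

Lemma step_sub m N f y z : (0 < N)%N -> ~~ odd N -> ell1 f -> ell1 y -> ell1 z ->
  forall n, step m N f y n - step m N f z n
    = step m N (fun=> 0) (fun n => y n - z n) n.
Proof.
move=> N0 Nev fl yl zl.
have rows_sub f1 f2 u w : step_tail m N (fun n => f1 n - f2 n) (fun n => u n - w n)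
    = fun n => step_tail m N f1 u n - step_tail m N f2 w n.
  apply/funext => n; rewrite /step_tail; case: ifP => _; first by rewrite subrr.
  by rewrite -mulrBl; congr (_ / _); ring.
have rows_ell1 u : ell1 u -> ell1 (step_tail m N f u).
  have rows_step g w : ell1 (step m N g w) -> ell1 (step_tail m N g w).
    move=> [D sD]; exists D; apply: ell1_leW sD => n.
    by rewrite /step; case: leqP => // nN; rewrite /step_tail nN normr0.
  move=> ul; have [D fD] := fl; have [E uE] := ul.
  have [D1 h1] : ell1 (step_tail m N f (fun=> 0)).
    by apply: rows_step; eexists; exact: (step_source_bound m N fD).
  have [D2 h2] : ell1 (step_tail m N (fun=> 0) u).
    by apply: rows_step; eexists; exact: (step_contraction m N0 Nev uE).
  exists (D1 + D2); have := ell1_leB h1 (ell1_leN h2).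
  rewrite -[X in ell1_le X _](_ : step_tail m N f u = _) //.
  apply/funext => n; rewrite opprK /step_tail; case: ifP => _; first by rewrite addr0.
  by rewrite -mulrDl; congr (_ / _); ring.
have E0 : step_tail m N (fun=> 0) (fun n => y n - z n)
    = fun n => step_tail m N f y n - step_tail m N f z n.
  rewrite -rows_sub; congr (step_tail _ _ _ _); apply/funext => n.
  by rewrite subrr.
move=> n; rewrite /step; case: leqP => nN; last by rewrite E0.
rewrite /step_head E0 alt_sumB; [|exact: rows_ell1|exact: rows_ell1].
rewrite (_ : vec N (fun=> 0) = 0); last by apply/matrixP => i j; rewrite !mxE.
rewrite mulmx0; set u := _ *m _; set w := first_col m N; set x := last_col m N.
by move: u w x => u w x; rewrite !mxE; ring.
Qed.

Lemma block_bound_rho m N : (0 < N)%N -> ~~ odd N -> Ltrunc m N \in unitmx ->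
  rho m N < 1 -> block_bound m (beta m N / (1 - rho m N)).
Proof.
move=> N0 Nev Lu r1 f C fC.
have fl : ell1 f by exists C.
have r0 : 0 <= rho m N.
  have := step_contraction m N0 Nev (ell1_le0 (ler01 : 0 <= 1 :> R)).
  by move=> /ell1_le_ge0; rewrite mulr1.
have r01 : 0 <= rho m N < 1 by rewrite r0 r1.
have contract y z D : ell1 y -> ell1 z -> ell1_le (fun n => y n - z n) D ->
    ell1_le (fun n => step m N f y n - step m N f z n) (rho m N * D).
  move=> yl zl yzD; rewrite (_ : (fun n => _) = step m N (fun=> 0) (fun n => y n - z n)).
    exact: step_contraction.
  by apply/funext => n; exact: step_sub.
have [y [yC fixy uniq]] := ell1_fixpoint r01 contract (step_source_bound m N fC).
have yl : ell1 y by eexists; exact: yC.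
exists y; split.
- by rewrite mulrAC.
- by apply/(step_fixP N0 Lu f yl).
- by move=> z zl Lz; apply: uniq => //; apply/(step_fixP N0 Lu f zl).
Qed.

Lemma block_boundW m K K' : K <= K' -> block_bound m K -> block_bound m K'.
Proof.
move=> KK H f C fC; have [y [yC Ly u]] := H f C fC; exists y; split=> //.
by apply: ell1_le_wtrans yC; rewrite ler_wpM2r // (ell1_le_ge0 fC).
Qed.

End BlockInverse.

(** * The inverse truncation from a Green's function *)

Section Columns.
Context {R : realType}.

(** What the columns of the inverse truncation need from the recurrence: a
    homogeneous solution [b] and a Green's function [G].  The case [m = 0], where
    the recurrence degenerates, has its own instance. *)
Record green_data (m : R) (N : nat) (b : nat -> R) (G : nat -> nat -> R) (K e : R) :
    Prop := GreenData {
  hom_ge0 : forall n, 0 <= b n;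
  hom_gt0 : 0 < b 0%N;
  hom_out : forall n, (N < n)%N -> b n = 0;
  hom_eq : forall n, (n < N)%N -> m * b n = 2 * n.+1%:R * b n.+1 + m * b n.+2;
  kernel0 : forall j, G j 0%N = 0;
  kernel_out : forall j n, (j < N)%N -> (N < n)%N -> G j n = 0;
  kernel_eq : forall j n, (j < N)%N -> (n < N)%N ->
    - m * G j n + 2 * n.+1%:R * G j n.+1 + m * G j n.+2 = (n == j)%:R;
  kernel_bound : forall j, (j < N)%N ->
    \sum_(0 <= n < N.+1) `|G j n| + `|\sum_(0 <= n < N.+1) G j n| <= K;
  kernel_last : \sum_(0 <= n < N.+1) `|G N.-1 n| <= e }.

Variables (m : R) (N : nat) (b : nat -> R) (G : nat -> nat -> R) (K e : R).
Hypotheses (N0 : (0 < N)%N) (D : green_data m N b G K e).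

Let B : R := \sum_(0 <= n < N.+1) weight n * b n.
Let S j : R := \sum_(0 <= n < N.+1) G j n.

(** The multiple of [b] restores row [0]: in the unknowns [(-1) ^ n y_n] this row
    is the weighted sum of the entries, which is [2 S] for [G] and [B] for [b]. *)
Definition inverse_col (j n : nat) : R :=
  (-1) ^+ (j + n) * (if j is j'.+1 then G j' n - 2 * S j' / B * b n else b n / B).

Let B_gt0 : 0 < B.
Proof.
rewrite /B big_ltn // mul1r; apply: ltr_pwDl; first exact: hom_gt0 D.
by apply: sumr_ge0 => n _; rewrite mulr_ge0 ?weight_ge0 ?(hom_ge0 D).
Qed.

Lemma inverse_col_out j n : (j <= N)%N -> (N < n)%N -> inverse_col j n = 0.
Proof.
move=> jN Nn; rewrite /inverse_col; case: j jN => [|j] jN.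
  by rewrite (hom_out D) // mul0r mulr0.
by rewrite (hom_out D) // (kernel_out D) // mulr0 subr0 mulr0.
Qed.

Let sqr1 n : (-1) ^+ n * (-1) ^+ n = 1 :> R.
Proof. by rewrite -exprD addnn -mul2n exprM sqrrN !expr1n. Qed.

Let SE j : S j = \sum_(1 <= n < N.+1) G j n.
Proof. by rewrite /S big_ltn // (kernel0 D) add0r. Qed.

Lemma Lop_inverse_col j i : (j <= N)%N -> (i <= N)%N ->
  Lop m (inverse_col j) i = (i == j)%:R.
Proof.
move=> jN iN; case: i iN => [|i] iN.
  rewrite Lop0 (@alt_sum_finite _ _ N); last by move=> n; exact: inverse_col_out.
  have E : \sum_(1 <= l < N.+1) (-1) ^+ l * inverse_col j l = (-1) ^+ j *
     \sum_(1 <= l < N.+1) (if j is j'.+1 then G j' l - 2 * S j' / B * b l else b l / B).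
    rewrite mulr_sumr; apply: eq_bigr => l _.
    by rewrite /inverse_col exprD mulrA mulrCA -!mulrA [X in _ * X]mulrA sqr1 mul1r.
  rewrite E {E} /inverse_col addn0 mulrCA -mulrDr.
  have BE := weighted_sumE b N; rewrite -/B in BE.
  case: j jN => [|j] jN.
    rewrite eqxx expr0 mul1r -mulr_suml mulrA -mulrDl -BE divff // gt_eqF //.
  rewrite (kernel0 D) sumrB -mulr_sumr -SE eq_sym /=.
  set s := \sum_(1 <= i < N.+1) b i in BE *.
  rewrite (_ : _ + _ = 2 * S j * (1 - (b 0%N + 2 * s) / B)); last by ring.
  by rewrite -BE divff ?subrr ?mulr0 // gt_eqF.
rewrite LopS /inverse_col !addnS !exprS.
have hb := hom_eq D iN; rewrite natrM.
case: j jN => [|j] jN.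
  rewrite add0n; set s := (-1) ^+ i; rewrite /=.
  transitivity (s / B * (m * b i - 2 * i.+1%:R * b i.+1 - m * b i.+2)).
    by ring.
  by rewrite hb; ring.
have hg := kernel_eq D jN iN; rewrite eqSS; set s := (-1) ^+ (j.+1 + i).
transitivity (- s * ((- m * G j i + 2 * i.+1%:R * G j i.+1 + m * G j i.+2)
   + 2 * S j / B * (m * b i - 2 * i.+1%:R * b i.+1 - m * b i.+2))).
  by ring.
rewrite hg hb; have [ij|_] := eqVneq i j; last by rewrite /=; ring.
rewrite /s ij -signr_odd (_ : odd _ = true) ?expr1; last lia.
by rewrite /=; ring.
Qed.

Let inverse : 'M[R]_N.+1 := \matrix_(i, j) inverse_col j i.

Lemma Ltrunc_inverse : Ltrunc m N *m inverse = 1%:M.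
Proof.
apply/matrixP => i j.
have -> : (Ltrunc m N *m inverse) i j = (Ltrunc m N *m vec N (inverse_col j)) i ord0.
  by rewrite !mxE; apply: eq_bigr => k _; rewrite !mxE.
rewrite Ltrunc_mul; last by move=> n Nn; apply: inverse_col_out; rewrite // -ltnS.
by rewrite !mxE Lop_inverse_col // -ltnS.
Qed.

Lemma Ltrunc_unit : Ltrunc m N \in unitmx.
Proof. by have [] := mulmx1_unit Ltrunc_inverse. Qed.

Lemma invmx_Ltrunc_col (j : 'I_N.+1) :
  col j (invmx (Ltrunc m N)) = vec N (inverse_col j).
Proof.
have -> : invmx (Ltrunc m N) = inverse.
  by rewrite -[RHS](mulKmx Ltrunc_unit) Ltrunc_inverse mulmx1.
by apply/matrixP => i k; rewrite !mxE.
Qed.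

Lemma inverse_col0_norm : ell1_vnorm (vec N (inverse_col 0)) = 1.
Proof.
rewrite vnorm_vec; transitivity ((\sum_(0 <= n < N.+1) weight n * b n) / B).
  rewrite mulr_suml; apply: eq_bigr => n _.
  rewrite normrM normrX normrN1 expr1n mul1r -mulrA ger0_norm //.
  by rewrite divr_ge0 ?(hom_ge0 D) // ltW.
by rewrite divff // gt_eqF.
Qed.

(** The weighted sum of [b] is [B], so that the correction costs at most
    [2 |S|], whatever [b] is. *)
Lemma inverse_colS_norm j : (j < N)%N ->
  ell1_vnorm (vec N (inverse_col j.+1)) <=
  2 * (\sum_(0 <= n < N.+1) `|G j n| + `|S j|).
Proof.
move=> jN; rewrite vnorm_vec.
apply: (@le_trans _ _ (\sum_(0 <= n < N.+1) weight n * `|G j n|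
    + `|2 * S j| / B * \sum_(0 <= n < N.+1) weight n * b n)).
  rewrite mulr_sumr -big_split /=; apply: ler_sum => n _.
  rewrite normrM normrX normrN1 expr1n mul1r mulrCA -mulrDr.
  rewrite ler_wpM2l ?weight_ge0 //; apply: le_trans (ler_normB _ _) _.
  rewrite lerD2l !normrM normfV (ger0_norm (hom_ge0 D n)) (gtr0_norm B_gt0).
  by [].
rewrite divfK ?gt_eqF // normrM ger0_norm // mulrDr lerD2r.
rewrite mulr_sumr !big_nat; apply: ler_sum => -[|n] _; rewrite ?(kernel0 D) ?normr0 ?mulr0 //.
Qed.

Lemma Ltrunc_bounds :
  [/\ Ltrunc m N \in unitmx, ell1_vnorm (first_col m N) = 1,
      mx_op_norm (invmx (Ltrunc m N)) <= Num.max 1 K &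
      ell1_vnorm (last_col m N) <= 4 * e].
Proof.
split; first exact: Ltrunc_unit.
- by rewrite /first_col invmx_Ltrunc_col inverse_col0_norm.
- apply: mx_op_norm_le; first by rewrite le_max ler01.
  move=> j; rewrite invmx_Ltrunc_col; case: j => -[|j] jN.
    by rewrite inverse_col0_norm mulr1 le_max lexx.
  apply: le_trans (inverse_colS_norm jN) _; rewrite /= mulrC ler_pM2r //.
  by apply: le_trans (kernel_bound D jN) _; rewrite le_max lexx orbT.
- rewrite /last_col invmx_Ltrunc_col /=.
  have jN : (N.-1 < N)%N by rewrite prednK.
  have -> : inverse_col N = inverse_col N.-1.+1 by rewrite prednK.
  apply: le_trans (inverse_colS_norm jN) _.
  have h : `|S N.-1| <= \sum_(0 <= n < N.+1) `|G N.-1 n| by exact: ler_norm_sum.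
  have := kernel_last D; lra.
Qed.

End Columns.

(** * Blocks with nonnegative mu *)

Section NonnegativeMu.
Context {R : realType}.

(** The factor of [1 / (2 N)] in [green_last]. *)
Definition last_col_const (m : R) : R := 1 + m / 2 * (1 + m / 2).

(** For [m = 0] the recurrence is diagonal: [b] is the unit sequence [0] and [G]
    the inverse diagonal. *)
Lemma green_data_mu0 N : (0 < N)%N ->
  green_data (0 : R) N (fun n => (n == 0%N)%:R)
    (fun j n => (n == j.+1)%:R / (2 * n%:R)) (4 / 3)
    ((2 * N%:R)^-1 * last_col_const 0).
Proof.
move=> N0.
have s j : (j < N)%N ->
    \sum_(0 <= n < N.+1) `|(n == j.+1)%:R / (2 * n%:R) : R| = (2 * j.+1%:R)^-1.
  move=> jN; rewrite big_mkord (bigD1 (Ordinal (jN : (j.+1 < N.+1)%N))) //=.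
  rewrite eqxx mul1r ger0_norm ?invr_ge0 ?mulr_ge0 // big1 ?addr0 // => i.
  by rewrite -val_eqE /= => /negPf ->; rewrite mul0r normr0.
split=> //.
- by move=> n; case: n => [|n] Nn.
- by move=> n nN; rewrite !mul0r mulr0 addr0.
- by move=> j; rewrite mul0r.
- by move=> j n jN Nn; rewrite gtn_eqF ?mul0r // (leq_ltn_trans jN).
- move=> j n jN nN; rewrite oppr0 !mul0r add0r addr0 eqSS mulrCA divff ?mulr1 //.
- move=> j jN; rewrite s //.
  have h : (2 * j.+1%:R)^-1 <= 2^-1 :> R.
    by rewrite lef_pV2 ?posrE ?mulr_gt0 // ler_peMr // ler1n.
  have : `|\sum_(0 <= n < N.+1) ((n == j.+1)%:R / (2 * n%:R) : R)| <= (2 * j.+1%:R)^-1.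
    by rewrite -(s _ jN); exact: ler_norm_sum.
  by move: h; set x := (_ * _)^-1; lra.
- by rewrite s ?prednK // /last_col_const !mul0r addr0 mulr1.
Qed.

Lemma green_data_mu_gt0 (m : R) N : 0 < m -> (2 < N)%N -> m ^+ 2 <= 4 * N%:R ->
  green_data m N (decaying m N) (green m N) (4 / 3) ((2 * N%:R)^-1 * last_col_const m).
Proof.
move=> m0 N2 Nm; split.
- exact: decaying_ge0.
- exact: decaying_gt0.
- by move=> n; exact: decaying_out.
- by move=> n; exact: decaying_rec.
- exact: green0.
- by move=> j n; exact: green_out.
- by move=> j n; exact: green_eq.
- move=> j jN; set A := \sum_(0 <= n < N.+1) `|_|; set S := \sum_(0 <= n < N.+1) _.
  have hB : A - S <= 1 by rewrite /A /S -sumrB; exact: green_sumB.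
  have hD : A + S <= 4 / 3 by rewrite /A /S -big_split; exact: green_sumD.
  by case: (ger0P S) => _; lra.
- case: N N2 Nm => [|[|N]] // N2 Nm /=; exact: green_last.
Qed.

(** [N] must be even, larger than [m ^ 2 / 4] for the estimates on the Green's
    function, and larger than [12 m (K + 2)] for [rho <= 1 / 12]. *)
Lemma block_bound_ge0 (m : R) : 0 <= m -> block_bound m (1455%:R / 1000%:R).
Proof.
move=> m0; pose K := last_col_const m.
have K1 : 1 <= K by rewrite /K /last_col_const lerDl !mulr_ge0 ?addr_ge0 ?divr_ge0.
pose x : R := m ^+ 2 + 12 * (m * (K + 2)).
have p1 : 0 <= m ^+ 2 by rewrite exprn_ge0.
have p2 : 0 <= m * (K + 2) by rewrite mulr_ge0 // addr_ge0 // (le_trans ler01).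
have x0 : 0 <= x by rewrite /x; lra.
have xA := archi_boundP x0; set A := Num.Def.archi_bound x in xA.
(* The shift by [2] makes [N] larger than [2] in all cases. *)
pose N := (2 * A.+2)%N.
have N2 : (2 < N)%N by rewrite /N; lia.
have N0 : (0 < N)%N by exact: ltn_trans N2.
have Nev : ~~ odd N by rewrite /N mul2n odd_double.
have NA : A%:R <= N%:R :> R by rewrite ler_nat /N; lia.
have xN : x <= N%:R by apply: le_trans NA; exact: ltW.
have Nm : m ^+ 2 <= 4 * N%:R.
  by have : 0 <= N%:R :> R := ler0n _ _; move: xN p1 p2; rewrite /x; lra.
have [Lu c1 opA cN] : [/\ Ltrunc m N \in unitmx, ell1_vnorm (first_col m N) = 1,
      mx_op_norm (invmx (Ltrunc m N)) <= Num.max 1 (4 / 3) &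
      ell1_vnorm (last_col m N) <= 4 * ((2 * N%:R)^-1 * K)].
  move: m0; rewrite le_eqVlt => /predU1P[m0|m0].
    by rewrite /K -m0; exact: (Ltrunc_bounds N0 (green_data_mu0 N0)).
  by exact: (Ltrunc_bounds N0 (green_data_mu_gt0 m0 N2 Nm)).
have NR : 0 < N%:R :> R by rewrite ltr0n.
set i := N%:R^-1 : R; have i0 : 0 < i by rewrite invr_gt0.
have hi k : (N < k)%N -> k%:R^-1 <= i.
  by move=> Nk; rewrite lef_pV2 ?posrE ?ltr0n ?(leq_trans _ Nk) // ler_nat ltnW.
have rho_le : rho m N <= m / 2 * ((2 * K + 4) * i).
  rewrite /rho ger0_norm // ler_wpM2l ?divr_ge0 // !ge_max; apply/and3P.
  have Ki : 0 <= K * i by apply: mulr_ge0; [exact: le_trans ler01 K1 | exact: ltW].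
  split.
  - rewrite /rho1 c1; have := hi N.+1 (ltnSn _); set u := N.+1%:R^-1 => h1; lra.
  - rewrite /rho2; have h := hi N.+2 (ltnW (ltnSn _)).
    have h1 := ell1_vnormD (last_col m N) (N.+2%:R^-1 *: first_col m N).
    rewrite ell1_vnormZ c1 mulr1 ger0_norm ?invr_ge0 // in h1.
    have : 4 * ((2 * N%:R)^-1 * K) = 2 * (K * i) by rewrite /i; field; rewrite gt_eqF.
    move=> cNE; rewrite cNE in cN; move: h h1; set u := N.+2%:R^-1; lra.
  - rewrite /rho3 c1 mulr1; have h1 := hi N.+1 (ltnSn _); have h3 := hi N.+3 (ltnW (ltnW (ltnSn _))).
    have : (N.+1%:R * N.+3%:R)^-1 <= i.
      apply: le_trans h1; rewrite lef_pV2 ?posrE ?mulr_gt0 ?ltr0n // ler_peMr //.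
      by rewrite ler1n.
    move: h1 h3; set u := N.+1%:R^-1; set w := N.+3%:R^-1; set z := (_ * _)^-1; lra.
have rho12 : rho m N <= 12^-1.
  apply: le_trans rho_le _.
  have -> : m / 2 * ((2 * K + 4) * i) = m * (K + 2) * i by field.
  rewrite -ler_pdivlMr ?invr_gt0 // invrK.
  by move: xN p1; rewrite /x; lra.
have beta_le : beta m N <= 4 / 3.
  rewrite /beta ge_max; apply/andP; split.
    by apply: le_trans opA _; rewrite ge_max lexx andbT; lra.
  rewrite c1 invfM; have : N.+1%:R^-1 <= 1 :> R by rewrite invf_le1 ?ler1n.
  set u := N.+1%:R^-1; lra.
apply: block_boundW (block_bound_rho N0 Nev Lu _); last by lra.
have r1 : 0 < 1 - rho m N by lra.
rewrite ler_pdivrMr //; lra.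
Qed.

End NonnegativeMu.

(** * From the blocks to the whole operator *)

Section Assembly.
Context {R : realType}.
Implicit Types (y : nat -> R) (nu : R).

Let abs_series y := (\sum_(1 <= j <oo) `|y j|%:E)%E.

Let abs_series_ge0 y : (0 <= abs_series y)%E.
Proof. by apply: nneseries_ge0 => j _ _; rewrite lee_fin. Qed.

Lemma ell1_norm_ge0 y : (0 <= ell1_norm y)%E.
Proof. by rewrite /ell1_norm adde_ge0 ?lee_fin // mule_ge0 ?lee_fin ?abs_series_ge0. Qed.

Lemma ell1_normP y C : (ell1_norm y <= C%:E)%E <-> ell1_le y C.
Proof.
split=> [yC|yC].
  case=> [|n].
    by rewrite big_geq // -lee_fin; exact: le_trans (ell1_norm_ge0 y) yC.
  rewrite (weighted_sumE (fun j => `|y j|)) -lee_fin; apply: le_trans yC.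
  rewrite /ell1_norm EFinD EFinM leeD2l // lee_pmul2l ?fin_num_fun ?lte_fin //.
  rewrite -sumEFin; apply: nneseries_lim_ge => j _ _; rewrite lee_fin //.
have part n : \sum_(1 <= j < n) `|y j| <= (C - `|y 0%N|) / 2.
  case: n => [|n].
    rewrite big_geq //; have := yC 1%N; rewrite big_nat1 mul1r; lra.
  have := yC n.+1; rewrite (weighted_sumE (fun j => `|y j|)); lra.
have : (abs_series y <= ((C - `|y 0%N|) / 2)%:E)%E.
  apply: lime_le; first by apply: is_cvg_nneseries => j _ _; rewrite lee_fin.
  by near=> n; rewrite sumEFin lee_fin.
move=> h; rewrite /ell1_norm -/(abs_series y).
apply: (@le_trans _ _ (`|y 0%N|%:E + 2%:E * ((C - `|y 0%N|) / 2)%:E)%E).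
  by rewrite leeD2l // lee_pmul2l ?lte_fin.
by rewrite -EFinM -EFinD lee_fin; lra.
Unshelve. all: by end_near. Qed.

Lemma ell1_norm_fin y : (ell1_norm y < +oo)%E <-> ell1 y.
Proof.
split=> [yoo|[C /ell1_normP yC]]; last exact: le_lt_trans yC (ltry _).
exists (fine (ell1_norm y)); apply/ell1_normP.
by rewrite fineK // ge0_fin_numE // ell1_norm_ge0.
Qed.

(** A block is, up to a positive weight, one of the nonnegative terms of a series
    with a finite sum. *)
Lemma X_norm_block nu (a : nat -> nat -> R) k : 0 < nu -> in_X nu a -> ell1 (a k).
Proof.
move=> nu0; rewrite /in_X /X_norm => aX; apply/ell1_norm_fin.
have nonneg j : (0 <= ell1_norm (a j) * (nu ^+ j)%:E)%E.
  by rewrite mule_ge0 ?ell1_norm_ge0 // lee_fin exprn_ge0 // ltW.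
have series_ge0 : (0 <= \sum_(1 <= j <oo) ell1_norm (a j) * (nu ^+ j)%:E)%E.
  by apply: nneseries_ge0 => j _ _; exact: nonneg.
case: k => [|k].
  by apply: le_lt_trans aX; rewrite leeDl // mule_ge0 ?lee_fin.
have soo : (\sum_(1 <= j <oo) ell1_norm (a j) * (nu ^+ j)%:E < +oo)%E.
  have : (2%:E * \sum_(1 <= j <oo) ell1_norm (a j) * (nu ^+ j)%:E < +oo)%E.
    by apply: le_lt_trans aX; rewrite leeDr // ell1_norm_ge0.
  by rewrite !ltey; apply: contra_neq => ->; rewrite gt0_muley ?lte_fin.
have : (ell1_norm (a k.+1) * (nu ^+ k.+1)%:E < +oo)%E.
  apply: le_lt_trans soo; apply: le_trans (nneseries_lim_ge k.+2 _); last first.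
    by move=> j _ _; exact: nonneg.
  rewrite big_nat_recr //= leeDr //; apply: sume_ge0 => j _; exact: nonneg.
by rewrite !ltey; apply: contra_neq => ->; rewrite gt0_mulye ?lte_fin ?exprn_gt0.
Qed.

Lemma X_norm_le nu (a b : nat -> nat -> R) (K : R) : 0 <= nu -> 0 <= K ->
  (forall k, (ell1_norm (a k) <= K%:E * ell1_norm (b k))%E) ->
  (X_norm nu a <= K%:E * X_norm nu b)%E.
Proof.
move=> nu0 K0 ab.
have nonneg (c : nat -> nat -> R) k : (0 <= ell1_norm (c k) * (nu ^+ k)%:E)%E.
  by rewrite mule_ge0 ?ell1_norm_ge0 // lee_fin exprn_ge0.
rewrite /X_norm ge0_muleDr ?ell1_norm_ge0 //; last first.
  by rewrite mule_ge0 ?lee_fin // nneseries_ge0.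
apply: leeD => //; rewrite muleCA lee_pmul2l ?lte_fin // -nneseriesZl //.
apply: lee_nneseries => [k _ _|k _]; first exact: nonneg.
by rewrite muleA lee_wpmul2r // lee_fin exprn_ge0.
Qed.

End Assembly.

Unset Implicit Arguments.

Theorem lemma3p30 (R : realType) (nu h : R) (d : nat) (gamma : nat -> R)
    (khat : nat) (N : nat -> nat)
    (nu_ge1 : 1 <= nu) (h_gt0 : 0 < h)
    (lambda_cvg : lambda d gamma k @[k --> \oo] --> -oo)
    (mu_ge0 : forall k, (khat < k)%N -> 0 <= mu h d gamma k)
    (N_gt0 : forall k, (k <= khat)%N -> (0 < N k)%N)
    (N_even : forall k, (k <= khat)%N -> ~~ odd (N k))
    (L_unit : forall k, (k <= khat)%N -> Ltrunc (mu h d gamma k) (N k) \in unitmx)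
    (rho_lt1 : forall k, (k <= khat)%N -> rho (mu h d gamma k) (N k) < 1) :
  exists Linv : (nat -> nat -> R) -> (nat -> nat -> R),
    is_inverse_on (in_X nu) (Lblock (mu h d gamma)) Linv /\
    (op_norm (X_norm nu) (X_norm nu) Linv <= (delta (mu h d gamma) N khat)%:E)%E.
Proof.
set M := mu h d gamma in mu_ge0 L_unit rho_lt1 *; set K := delta M N khat.
have base_le : 1455%:R / 1000%:R <= K by exact: bigmax_ge_id.
have K0 : 0 <= K by apply: le_trans base_le; apply: divr_ge0; exact: ler0n.
have bound k : block_bound (M k) K.
  have [kk|kk] := leqP k khat; last first.
    by apply: block_boundW base_le _; apply: block_bound_ge0; exact: mu_ge0.
  apply: block_boundW (block_bound_rho (N_gt0 k kk) (N_even k kk) (L_unit k kk) (rho_lt1 k kk)).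
  exact: (le_bigmax _ _ (Ordinal (kk : (k < khat.+1)%N))).
have solve k f : {y : nat -> R | ell1 f ->
    [/\ (ell1_norm y <= K%:E * ell1_norm f)%E, Lop (M k) y = f &
      forall z, ell1 z -> Lop (M k) z = f -> z = y]}.
  apply: cid; have [fl|nfl] := pselect (ell1 f); last by exists f.
  have fin : ell1_norm f \is a fin_num.
    by rewrite ge0_fin_numE ?ell1_norm_ge0 //; apply/ell1_norm_fin.
  have fC : ell1_le f (fine (ell1_norm f)) by apply/ell1_normP; rewrite fineK.
  have [y [yC Ly uniq]] := bound k f _ fC; exists y => _; split=> //.
  by rewrite -(fineK fin) -EFinM; apply/ell1_normP.
pose Linv (a : nat -> nat -> R) k := sval (solve k (a k)).
have nu0 : 0 < nu := lt_le_trans ltr01 nu_ge1.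
have LinvP a : in_X nu a -> forall k,
    [/\ (ell1_norm (Linv a k) <= K%:E * ell1_norm (a k))%E, Lop (M k) (Linv a k) = a k &
      forall z, ell1 z -> Lop (M k) z = a k -> z = Linv a k].
  move=> aX k; have sol := svalP (solve k (a k)); apply: sol.
  exact: X_norm_block nu0 aX.
have Linv_le a : in_X nu a -> (X_norm nu (Linv a) <= K%:E * X_norm nu a)%E.
  by move=> aX; apply: X_norm_le => // [|k]; [exact: ltW | have [] := LinvP a aX k].
exists Linv; split.
  move=> y yX; split; [split|].
  - apply: le_lt_trans (Linv_le y yX) _; rewrite lte_mul_pinfty ?lee_fin //.
  - by apply/funext => k; have [] := LinvP y yX k.
  - move=> a [aX La]; apply/funext => k; have [_ _ uniq] := LinvP y yX k.
    by apply/esym/uniq; [exact: X_norm_block nu0 aX | rewrite -La].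
apply: ge_ereal_sup => _ [a a1 <-].
have aX : in_X nu a by apply: le_lt_trans a1 (ltry _).
apply: le_trans (Linv_le a aX) _.
by rewrite -[leRHS]mule1 lee_wpmul2l ?lee_fin.
Qed.
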